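(* Let $V$ be a finite-dimensional real normed space, $m\ge 1$ an integer, $p\ge 1$ a real number, and $\omega$ a control which is zero only on the diagonal. Let $X,Y$ be $G^{m}(V)$-valued paths with $p$-variation controlled by $\omega$, i.e. $\|X_{s,t}\|_m^p\le\omega(s,t)$ and $\|Y_{s,t}\|_m^p\le\omega(s,t)$ for all $0\le s\le t\le 1$. Let $d$ denote $d_{m}$ or $d_{r,m}$. There exists a constant $c=c(\|X\|_{\infty},m)$ such that for every $\varepsilon$ with $0<\varepsilon<1/(\omega(0,1)\vee 1)$ and all $0\le s<t\le 1$, $$\max_{k=1,\dots,m}\frac{|X_{s,t}^{k}-Y_{s,t}^{k}|}{\omega(s,t)^{k/p}}\le\varepsilon\ \Longrightarrow\ d(X_{s,t},Y_{s,t})\le c\,\varepsilon^{1/m}\,\omega(s,t)^{1/p},$$ $$d(X_{s,t},Y_{s,t})\le\varepsilon\,\omega(s,t)^{1/p}\ \Longrightarrow\ \max_{k=1,\dots,m}\frac{|X_{s,t}^{k}-Y_{s,t}^{k}|}{\omega(s,t)^{k/p}}\le c\,\varepsilon .$$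
   Context: $T^{(m)}(V)=\bigoplus_{n=0}^{m}V^{\otimes n}$ is the truncated tensor algebra with (truncated) product $\otimes$; $\mathcal{G}^{m}(V)$ is its Lie subalgebra generated by $V$ for the bracket $[a,b]=a\otimes b-b\otimes a$; $G^{m}(V)=\exp(\mathcal{G}^{m}(V))$ is the free nilpotent Lie group of step $m$ over $V$, with product $\otimes$ and neutral element $1$. For $g\in T^{(m)}(V)$, $g^{k}\in V^{\otimes k}$ denotes its component of degree $k$. Norms, all denoted $|\cdot|$, are fixed on the spaces $V^{\otimes i}$ with $|a\otimes b|\le|a|\,|b|$ for $a\in V^{\otimes i},b\in V^{\otimes j}$. The dilation is $\delta_{t}(1+v_{1}+\dots+v_{m})=1+tv_{1}+\dots+t^{m}v_{m}$, $v_i\in V^{\otimes i}$, $t\in\mathbb{R}$. $\|\cdot\|_{m}$ is a fixed symmetric subadditive homogeneous norm on $G^{m}(V)$, i.e. a function $G^m(V)\to[0,\infty)$ with $\|g\|_m=0$ iff $g=1$, $\|\delta_t g\|_m=|t|\,\|g\|_m$, $\|g\otimes h\|_m\le\|g\|_m+\|h\|_m$, $\|g^{-1}\|_m=\|g\|_m$ (for instance $\max_{i}(i!|g^i|)^{1/i}$ or the Carnot–Caratheodory norm; all such norms are equivalent since $\dim V<\infty$). $d_{m}(g,h)=\|g^{-1}\otimes h\|_{m}$ is the left invariant distance and $d_{r,m}(g,h)=\|g\otimes h^{-1}\|_{m}$ the right invariant one. ($V$ and all these norms are regarded as fixed, so $c$ may depend on them.) A $G^m(V)$-valued path is a continuous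 map $[0,1]\to G^{m}(V)$ starting at $1$; for such a path $Y_{s,t}:=Y_{s}^{-1}\otimes Y_{t}$, and $\|X\|_\infty=\sup_{s\le t}\|X_{s,t}\|_m$. A control is a continuous function $\omega:\{(s,t):0\le s\le t\le 1\}\to[0,\infty)$ with $\omega(t,t)=0$ for all $t$ and $\omega(s,t)+\omega(t,u)\le\omega(s,u)$ for $s<t<u$. *)

(* Defs.v *)
From HB Require Import structures.
From mathcomp Require Import all_boot all_order all_algebra.
From mathcomp Require Import all_classical all_reals all_analysis.
Import Order.TTheory GRing.Theory Num.Theory.
Import numFieldNormedType.Exports.

Set Implicit Arguments.
Unset Strict Implicit.
Unset Printing Implicit Defensive.

Local Open Scope classical_set_scope.
Local Open Scope ring_scope.

(* Tensors are given by their coordinates in the basis of V^{(x)k} induced by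
   the basis [vbasis {:V}] of V: the basis tensors of degree k are the words of
   length k over the alphabet ['I_(\dim {:V})], and those of the truncated
   tensor algebra are the words of length at most m. *)
Section TensorAlgebra.
Variables (R : fieldType) (V : vectType R).

Definition letter := 'I_(\dim {:V}).

Definition tensor (k : nat) := {ffun k.-tuple letter -> R^o}.

Definition tensor_mul (i j : nat) (a : tensor i) (b : tensor j) :
    tensor (i + j) :=
  [ffun w : (i + j).-tuple letter =>
     a [tuple tnth w (lshift j k) | k < i]
     * b [tuple tnth w (rshift i k) | k < j]].

Variable m : nat.

Definition ttensor := {ffun m.-bseq letter -> R^o}.

HB.instance Definition _ :=
  GRing.Lmodule.copy ttensor {ffun m.-bseq letter -> R^o}.

Definition tcoef (g : ttensor) (w : m.-bseq letter) : R := g w.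

(* Words of length greater than m have been truncated away. *)
Definition component (g : ttensor) (k : nat) : tensor k :=
  [ffun w : k.-tuple letter => oapp (tcoef g) 0 (insub (w : seq letter))].

Definition tone : ttensor := [ffun w : m.-bseq letter => (w == [bseq])%:R].

Definition tmul (g h : ttensor) : ttensor :=
  [ffun w : m.-bseq letter =>
     \sum_(u : m.-bseq letter) \sum_(v : m.-bseq letter | u ++ v == w :> seq _)
       tcoef g u * tcoef h v].

Lemma ttensorP (g h : ttensor) : tcoef g =1 tcoef h <-> g = h.
Proof. by split=> [|->] // gh; apply/ffunP. Qed.

Lemma tcoefD g h w : tcoef (g + h) w = tcoef g w + tcoef h w.
Proof. by rewrite /tcoef ffunE. Qed.

Lemma tcoefZ c g w : tcoef (c *: g) w = c * tcoef g w.
Proof. by rewrite /tcoef ffunE. Qed.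

Lemma tcoef0 w : tcoef 0 w = 0.
Proof. by rewrite /tcoef ffunE. Qed.

Lemma tcoef1 w : tcoef tone w = (w == [bseq])%:R.
Proof. by rewrite /tcoef ffunE. Qed.

Lemma tcoefM g h w : tcoef (tmul g h) w =
  \sum_(u : m.-bseq letter) \sum_(v : m.-bseq letter | u ++ v == w :> seq _)
    tcoef g u * tcoef h v.
Proof. by rewrite {1}/tcoef ffunE. Qed.

Lemma tmulA : associative tmul.
Proof.
have sum_word (s : seq letter) (F : m.-bseq letter -> R) : (size s <= m)%N ->
    \sum_(x : m.-bseq letter | s == x :> seq _) F x = F (insub_bseq m s).
  move=> sm; rewrite (big_pred1 (insub_bseq m s)) // => x.
  by rewrite /= -val_eqE /= /insub_bseq insubdK // eq_sym.
move=> a b c; apply/ttensorP => w; rewrite !tcoefM.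
transitivity (\sum_(u : m.-bseq letter) \sum_(v : m.-bseq letter)
   \sum_(y : m.-bseq letter | u ++ v ++ y == w :> seq _)
     tcoef a u * tcoef b v * tcoef c y).
  apply: eq_bigr => u _.
  under eq_bigr => x _.
    rewrite tcoefM mulr_sumr; under eq_bigr do rewrite mulr_sumr big_mkcond.
    over.
  rewrite exchange_big; apply: eq_bigr => v _ /=.
  rewrite exchange_big [RHS]big_mkcond; apply: eq_bigr => y _ /=.
  have [e|ne] := eqVneq (u ++ v ++ y) w.
    have s_le : (size (v ++ y) <= m)%N.
      apply: leq_trans (size_bseq w); rewrite -e [(size (u ++ _))%N]size_cat.
      exact: leq_addl.
    rewrite -big_mkcondr /=.
    rewrite -[RHS](sum_word (v ++ y)
      (fun=> tcoef a u * tcoef b v * tcoef c y)) //.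
    apply: eq_big => [x|x _]; last by rewrite mulrA.
    by case: (eqVneq (v ++ y) x) => [<-|]; rewrite ?andbF ?andbT // e eqxx.
  rewrite -big_mkcondr big1 // => x /andP[/eqP e /eqP e'].
  by rewrite e' e eqxx in ne.
symmetry.
under eq_bigr => x _.
  under eq_bigr => y _.
    rewrite tcoefM mulr_suml; under eq_bigr do rewrite mulr_suml big_mkcond.
    over.
  rewrite exchange_big.
  over.
rewrite exchange_big; apply: eq_bigr => u _ /=.
under eq_bigr do rewrite exchange_big.
rewrite exchange_big; apply: eq_bigr => v _ /=.
under eq_bigr do rewrite big_mkcond.
rewrite exchange_big [RHS]big_mkcond; apply: eq_bigr => y _ /=.
have [e|ne] := eqVneq (u ++ v ++ y) w.
  have s_le : (size (u ++ v) <= m)%N.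
    apply: leq_trans (size_bseq w); rewrite -e catA.
    rewrite [(size ((u ++ v) ++ _))%N]size_cat.
    exact: leq_addr.
  rewrite -[RHS](sum_word (u ++ v)
      (fun=> tcoef a u * tcoef b v * tcoef c y)) //.
  rewrite [RHS]big_mkcond; apply: eq_bigr => x _.
  case: (eqVneq (u ++ v) x) => [<-|]; last by rewrite if_same.
  by rewrite -catA e eqxx.
rewrite big1 // => x _; case: eqP => // e; case: eqP => // e'.
by rewrite catA e' e eqxx in ne.
Qed.

Lemma tmul1l : left_id tone tmul.
Proof.
move=> g; apply/ttensorP => w; rewrite tcoefM (bigD1 [bseq]) //=.
rewrite [X in _ + X]big1 ?addr0.
  rewrite (big_pred1 w) => [|v]; last by rewrite /= -val_eqE.
  by rewrite tcoef1 eqxx mul1r.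
by move=> u une; rewrite big1 // => v _; rewrite tcoef1 (negPf une) mul0r.
Qed.

Lemma tmul1r : right_id tone tmul.
Proof.
move=> g; apply/ttensorP => w; rewrite tcoefM (bigD1 w) //=.
rewrite [X in _ + X]big1 ?addr0.
  rewrite (big_pred1 [bseq]) => [|v]; first by rewrite tcoef1 eqxx mulr1.
  by rewrite /= -val_eqE -{2}[bseqval w]cats0 eqseq_cat // eqxx.
move=> u une; rewrite big1 // => v; rewrite tcoef1 -val_eqE /=.
case: (eqVneq (v : seq _)) => [->|]; last by rewrite mulr0.
by rewrite cats0 => /eqP/val_inj e; rewrite e eqxx in une.
Qed.

Lemma tmulDl : left_distributive tmul +%R.
Proof.
move=> a b c; apply/ttensorP => w; rewrite tcoefD !tcoefM -big_split.
apply: eq_bigr => u _; rewrite -big_split; apply: eq_bigr => v _.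
by rewrite tcoefD mulrDl.
Qed.

Lemma tmulDr : right_distributive tmul +%R.
Proof.
move=> a b c; apply/ttensorP => w; rewrite tcoefD !tcoefM -big_split.
apply: eq_bigr => u _; rewrite -big_split; apply: eq_bigr => v _.
by rewrite tcoefD mulrDr.
Qed.

Lemma tone_neq0 : tone != 0.
Proof.
apply/eqP => /ttensorP/(_ [bseq])/eqP.
by rewrite tcoef1 tcoef0 eqxx oner_eq0.
Qed.

HB.instance Definition _ := GRing.Zmodule_isNzRing.Build ttensor
  tmulA tmul1l tmul1r tmulDl tmulDr tone_neq0.

Lemma tscalerAl (c : R) (g h : ttensor) : c *: (g * h) = (c *: g) * h.
Proof.
apply/ttensorP => w; rewrite tcoefZ !tcoefM mulr_sumr; apply: eq_bigr => u _.
by rewrite mulr_sumr; apply: eq_bigr => v _; rewrite tcoefZ mulrA.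
Qed.

HB.instance Definition _ := GRing.Lmodule_isLalgebra.Build R ttensor tscalerAl.

Lemma tscalerAr (c : R) (g h : ttensor) : c *: (g * h) = g * (c *: h).
Proof.
apply/ttensorP => w; rewrite tcoefZ !tcoefM mulr_sumr; apply: eq_bigr => u _.
by rewrite mulr_sumr; apply: eq_bigr => v _; rewrite tcoefZ mulrCA.
Qed.

HB.instance Definition _ := GRing.Lalgebra_isAlgebra.Build R ttensor tscalerAr.

(* The degree 0 component; g is invertible if and only if it is nonzero, and
   the inverse is then a finite geometric series. *)
Definition scalar_part (g : ttensor) : R := tcoef g [bseq].

Definition tunit : pred ttensor := fun g => scalar_part g != 0.

Definition tinv (g : ttensor) : ttensor :=
  if tunit g then
    let c := (scalar_part g)^-1 in c *: \sum_(k < m.+1) (1 - c *: g) ^+ k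
  else g.

Lemma scalar_partM g h : scalar_part (g * h) = scalar_part g * scalar_part h.
Proof.
rewrite /scalar_part tcoefM (bigD1 [bseq]) //= [X in _ + X]big1 ?addr0.
  by rewrite (big_pred1 [bseq]).
move=> u une; rewrite big_pred0 // => v; apply/negP => /eqP/(congr1 size).
rewrite size_cat /= => /eqP; rewrite addn_eq0 => /andP[/nilP e _].
by move: une; rewrite -val_eqE /= e.
Qed.

Lemma tensor_nilp (g : ttensor) : scalar_part g = 0 -> g ^+ m.+1 = 0.
Proof.
move=> g0; suff low k (w : m.-bseq letter) :
    (size w < k)%N -> tcoef (g ^+ k) w = 0.
  by apply/ttensorP => w; rewrite tcoef0 low // ltnS size_bseq.
elim: k w => // k IHk w wk; rewrite exprS tcoefM big1 // => u _.
rewrite big1 // => v /eqP e; have [u0|une] := eqVneq u [bseq].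
  by rewrite u0 -/(scalar_part g) g0 mul0r.
rewrite IHk ?mulr0 // -ltnS; apply: leq_trans wk; rewrite -e size_cat.
by rewrite ltnS -[X in (X < _)%N]add0n ltn_add2r lt0n size_eq0 -val_eqE
  in une *.
Qed.

Lemma tinvP g : tunit g -> tinv g * g = 1 /\ g * tinv g = 1.
Proof.
move=> ug; rewrite /tinv ug; set c := (scalar_part g)^-1.
have nil : (1 - c *: g) ^+ m.+1 = 0.
  apply: tensor_nilp; rewrite /scalar_part tcoefD -scaleN1r !tcoefZ tcoef1 eqxx.
  by rewrite -/(scalar_part g) mulVf // mulN1r subrr.
have := subrX1 (1 - c *: g) m.+1; rewrite nil sub0r.
rewrite addrAC subrr add0r mulNr => /oppr_inj e.
have comm : GRing.comm g (\sum_(k < m.+1) (1 - c *: g) ^+ k).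
  apply: commr_sum => k _; apply/commrX/commrB; first exact: commr1.
  by rewrite /GRing.comm -scalerAl -scalerAr.
by rewrite -scalerAl -scalerAr -comm scalerAl -e.
Qed.

Lemma tmulVr : {in tunit, left_inverse 1 tinv *%R}.
Proof. by move=> g /tinvP[]. Qed.

Lemma tmulrV : {in tunit, right_inverse 1 tinv *%R}.
Proof. by move=> g /tinvP[]. Qed.

Lemma tunitP (g h : ttensor) : h * g = 1 /\ g * h = 1 -> tunit g.
Proof.
move=> [e _]; apply/negP => /eqP g0; move/(congr1 scalar_part): e.
rewrite scalar_partM g0 mulr0 /scalar_part tcoef1 eqxx.
by move=> /eqP; rewrite eq_sym oner_eq0.
Qed.

Lemma tinv_out : {in [predC tunit], tinv =1 id}.
Proof. by move=> g; rewrite inE /= /tinv; case: ifP => // ug /negP[]. Qed.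

HB.instance Definition _ := GRing.NzRing_hasMulInverse.Build ttensor
  tmulVr tmulrV tunitP tinv_out.

End TensorAlgebra.

Section FreeNilpotentGroup.
Variables (R : fieldType) (V : vectType R) (m : nat).
Local Notation T := (ttensor V m).

(* The inclusion of V = V^{(x)1} in the truncated tensor algebra (m >= 1). *)
Definition tvec (v : V) : T :=
  [ffun w : m.-bseq (letter V) =>
     \sum_(i < \dim {:V})
       coord (vbasis {:V}) i v * ((w : seq (letter V)) == [:: i])%:R].

Inductive free_lie : T -> Prop :=
| free_lie_vec v : free_lie (tvec v)
| free_lieD a b : free_lie a -> free_lie b -> free_lie (a + b)
| free_lieZ (c : R) a : free_lie a -> free_lie (c *: a)
| free_lie_bracket a b :
    free_lie a -> free_lie b -> free_lie (a * b - b * a).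

(* Used on tensors without degree 0 component, for which the powers of
   exponent greater than m vanish. *)
Definition texp (a : T) : T := \sum_(k < m.+1) (k`!%:R)^-1 *: a ^+ k.

Definition free_nilpotent_group : set T := texp @` free_lie.

Definition dilation (t : R) (g : T) : T :=
  [ffun w : m.-bseq (letter V) => t ^+ size w * tcoef g w].

End FreeNilpotentGroup.

Section RoughPaths.
Variable R : realType.

(* Nonnegativity follows from the three conditions.  The norm of V itself is
   the one given on [tensor V 1]. *)
Definition is_norm (E : lmodType R) (N : E -> R) : Prop :=
  [/\ forall x y, N (x + y) <= N x + N y,
      forall (a : R) x, N (a *: x) = `|a| * N x
    & forall x, N x = 0 -> x = 0].

Variables (V : vectType R) (m : nat).
Local Notation T := (ttensor V m).
Local Notation G := (@free_nilpotent_group R V m).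

(* The values of nu outside of the group are irrelevant. *)
Definition is_homogeneous_norm (nu : T -> R) : Prop :=
  [/\ forall g, G g -> 0 <= nu g,
      forall g, G g -> (nu g = 0 <-> g = 1),
      forall (t : R) g, G g -> nu (dilation t g) = `|t| * nu g,
      forall g h, G g -> G h -> nu (g * h) <= nu g + nu h
    & forall g, G g -> nu g^-1 = nu g].

Definition dist_left (nu : T -> R) (g h : T) : R := nu (g^-1 * h).
Definition dist_right (nu : T -> R) (g h : T) : R := nu (g * h^-1).

(* The topology of the finite-dimensional space T is that of coordinatewise
   convergence. *)
Definition is_group_path (X : R -> T) : Prop :=
  [/\ forall t, 0 <= t <= 1 -> G (X t),
      forall w, {within `[0, 1], continuous (fun t : R => tcoef (X t) w)}
    & X 0 = 1].

Definition increment (X : R -> T) (s t : R) : T := (X s)^-1 * X t.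

Definition simplex : set (R * R) :=
  [set u | [/\ 0 <= u.1, u.1 <= u.2 & u.2 <= 1]].

Definition path_sup_norm (nu : T -> R) (X : R -> T) : R :=
  sup [set nu (increment X u.1 u.2) | u in simplex].

Definition is_control (om : R -> R -> R) : Prop :=
  [/\ {within simplex, continuous (fun u : R * R => om u.1 u.2)},
      forall s t, simplex (s, t) -> 0 <= om s t,
      forall t, 0 <= t <= 1 -> om t t = 0
    & forall s t u, 0 <= s -> s < t -> t < u -> u <= 1 ->
        om s t + om t u <= om s u].

Definition zero_only_on_diagonal (om : R -> R -> R) : Prop :=
  forall s t, simplex (s, t) -> om s t = 0 -> s = t.

Definition pvar_controlled (nu : T -> R) (p : R) (om : R -> R -> R)
    (X : R -> T) : Prop :=
  forall s t, simplex (s, t) -> nu (increment X s t) `^ p <= om s t.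

(* The quotients are nonnegative, so that starting the maximum from 0 is
   harmless. *)
Definition scaled_diff (N : forall k, tensor V k -> R) (p w : R)
    (g h : T) : R :=
  \big[Num.max/0]_(1 <= k < m.+1)
    (N k (component g k - component h k) / w `^ (k%:R / p)).

End RoughPaths.

(* Main.v *)
Require Import Defs.
From HB Require Import structures.
From mathcomp Require Import all_boot all_order all_algebra.
From mathcomp Require Import all_classical all_reals all_analysis.
Import Order.TTheory GRing.Theory Num.Theory.
Import numFieldNormedType.Exports.

(* Dilating by [om(s,t)^(-1/p)] turns the increments into elements [g], [h] of
   the unit ball of [nu], and both implications follow from a comparison of
   [nu] with the l1 norm [|.|] of the coordinates, on the whole group [G].

   - [G] is a group: with [E] the derivation multiplying degree k by k, an
     element [g] with scalar part 1 lies in [G] iff [g^-1 E g] is a Lie element,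
     and [(gh)^-1 E(gh) = h^-1 (g^-1 E g) h + h^-1 E h].
   - [nu] is bounded on the bounded subsets of [G]: if [b_i] is a basis of the
     Lie elements of degree k, [nu (exp (c b_i)) = |c|^(1/k) nu (exp b_i)] by
     dilation, and multiplying by a product of such exponentials kills the lowest
     degree part of [g - 1].  Dilating again, [|g - 1| <= e] gives
     [nu g <= C e^(1/m)]; in particular [nu] is continuous.
   - [nu o exp] therefore has a positive minimum on the compact set of Lie
     elements of norm in [1, M], which by homogeneity bounds the coordinates of
     [log g] by powers of [nu g]. *)

Set Implicit Arguments.
Unset Strict Implicit.
Unset Printing Implicit Defensive.

Local Open Scope ring_scope.

(** * Filtration by order, homogeneous parts, Euler derivation and dilations *)

Section Grading.
Variables (R : numFieldType) (V : vectType R) (m : nat).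
Local Notation T := (ttensor V m).
Implicit Types (a b g h : T) (w : m.-bseq (letter V)) (s t : R).

Lemma tcoefN a w : tcoef (- a) w = - tcoef a w.
Proof. by rewrite -scaleN1r tcoefZ mulN1r. Qed.

Lemma tcoefB a b w : tcoef (a - b) w = tcoef a w - tcoef b w.
Proof. by rewrite tcoefD tcoefN. Qed.

Lemma tcoef_sum I (r : seq I) (P : pred I) (F : I -> T) w :
  tcoef (\sum_(i <- r | P i) F i) w = \sum_(i <- r | P i) tcoef (F i) w.
Proof. by apply: (big_morph (fun a : T => tcoef a w)) => [a b|]; rewrite ?tcoefD ?tcoef0. Qed.

Lemma tcoef1E w : tcoef (1 : T) w = (w == [bseq])%:R.
Proof. exact: tcoef1. Qed.

(** The decreasing filtration by lowest degree. [order_ge 1] is the augmentation ideal, and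
    [order_ge m.+1] contains only 0 by truncation. *)
Definition order_ge (k : nat) a := forall w, (size w < k)%N -> tcoef a w = 0.

Lemma order_ge0 k : order_ge k 0.
Proof. by move=> w _; rewrite tcoef0. Qed.

Lemma order_geD k a b : order_ge k a -> order_ge k b -> order_ge k (a + b).
Proof. by move=> ha hb w wk; rewrite tcoefD ha // hb // addr0. Qed.

Lemma order_geZ k (c : R) a : order_ge k a -> order_ge k (c *: a).
Proof. by move=> ha w wk; rewrite tcoefZ ha // mulr0. Qed.

Lemma order_geN k a : order_ge k a -> order_ge k (- a).
Proof. by move=> ha; rewrite -scaleN1r; exact: order_geZ. Qed.

Lemma order_geB k a b : order_ge k a -> order_ge k b -> order_ge k (a - b).
Proof. by move=> ha hb; apply: order_geD => //; exact: order_geN. Qed.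

Lemma order_ge_sum k I (r : seq I) (P : pred I) (F : I -> T) :
  (forall i, P i -> order_ge k (F i)) ->
  order_ge k (\sum_(i <- r | P i) F i).
Proof.
by move=> hF; apply: big_ind => //; [exact: order_ge0 | exact: order_geD].
Qed.

Lemma order_geW j k a : (j <= k)%N -> order_ge k a -> order_ge j a.
Proof. by move=> jk ha w wj; apply: ha; exact: leq_trans jk. Qed.

Lemma order_geM j k a b :
  order_ge j a -> order_ge k b -> order_ge (j + k) (a * b).
Proof.
move=> ha hb w wk; rewrite tcoefM big1 // => u _; rewrite big1 // => v /eqP e.
have [uj|ju] := ltnP (size u) j; first by rewrite ha // mul0r.
rewrite hb ?mulr0 //; move: wk; rewrite -e size_cat.
by apply: contraTT; rewrite -!leqNgt; exact: leq_add.
Qed.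

Lemma order_geX a n : order_ge 1 a -> order_ge n (a ^+ n).
Proof.
move=> ha; elim: n => [|n IHn]; first by [].
by rewrite exprS -add1n; exact: order_geM.
Qed.

Lemma order_ge_eq0 a : order_ge m.+1 a -> a = 0.
Proof. by move=> ha; apply/ttensorP => w; rewrite tcoef0 ha // ltnS size_bseq. Qed.

Lemma order_ge1_expr a n : order_ge 1 a -> (m < n)%N -> a ^+ n = 0.
Proof. by move=> ha mn; apply/order_ge_eq0/(order_geW mn)/order_geX. Qed.

(** Unlike [component], the homogeneous part stays inside the algebra, so it can be multiplied and
    tested for being a Lie element. *)
Definition degree_part (k : nat) a : T :=
  [ffun w : m.-bseq (letter V) => if size w == k then tcoef a w else 0].

Lemma tcoef_degree_part k a w :
  tcoef (degree_part k a) w = if size w == k then tcoef a w else 0.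
Proof. by rewrite {1}/tcoef ffunE. Qed.

Lemma degree_partD k a b :
  degree_part k (a + b) = degree_part k a + degree_part k b.
Proof.
apply/ttensorP => w; rewrite tcoefD !tcoef_degree_part tcoefD.
by case: ifP; rewrite ?addr0.
Qed.

Lemma degree_partZ k (c : R) a :
  degree_part k (c *: a) = c *: degree_part k a.
Proof.
apply/ttensorP => w; rewrite tcoefZ !tcoef_degree_part tcoefZ.
by case: ifP; rewrite ?mulr0.
Qed.

Lemma degree_partB k a b :
  degree_part k (a - b) = degree_part k a - degree_part k b.
Proof. by rewrite degree_partD -[- b]scaleN1r degree_partZ scaleN1r. Qed.

Lemma degree_part_id k a : degree_part k (degree_part k a) = degree_part k a.
Proof.
by apply/ttensorP => w; rewrite !tcoef_degree_part; case: ifP => // ->.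
Qed.

Lemma order_ge_degree_part k a : order_ge k (degree_part k a).
Proof. by move=> w wk; rewrite tcoef_degree_part ltn_eqF. Qed.

Lemma order_geS k a : order_ge k a -> order_ge k.+1 (a - degree_part k a).
Proof.
move=> ha w; rewrite ltnS leq_eqVlt => /predU1P[e|wk].
  by rewrite tcoefB tcoef_degree_part e eqxx subrr.
by rewrite tcoefB tcoef_degree_part ltn_eqF // ha // subr0.
Qed.

Lemma degree_part_order_ge k a : order_ge k.+1 a -> degree_part k a = 0.
Proof.
move=> ha; apply/ttensorP => w; rewrite tcoef_degree_part tcoef0.
by case: eqP => // e; rewrite ha // e.
Qed.

Lemma degree_partM k a b : degree_part k (a * b) =
  \sum_(i < k.+1) degree_part i a * degree_part (k - i) b.
Proof.
apply/ttensorP => w; rewrite tcoef_degree_part tcoef_sum.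
under [RHS]eq_bigr do rewrite tcoefM.
rewrite exchange_big; under [RHS]eq_bigr do rewrite exchange_big.
rewrite tcoefM; case: eqP => [wk|wk]; last first.
  rewrite big1 // => u _; rewrite big1 // => v /eqP e; rewrite big1 // => i _.
  rewrite !tcoef_degree_part; case: eqP => [ui|]; last by rewrite mul0r.
  case: eqP => [vi|]; last by rewrite mulr0.
  by case: wk; rewrite -e size_cat ui vi subnKC // -ltnS.
apply: eq_bigr => u _; apply: eq_bigr => v /eqP e.
have uvk : k = (size u + size v)%N by rewrite -wk -e size_cat.
have uk : (size u < k.+1)%N by rewrite ltnS uvk leq_addr.
rewrite (bigD1 (Ordinal uk)) //= big1 ?addr0 => [|i iu].
  by rewrite !tcoef_degree_part eqxx uvk addKn eqxx.
rewrite tcoef_degree_part; case: eqP => [ui|]; last by rewrite mul0r.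
by case/eqP: iu; apply: val_inj.
Qed.

(** The derivation E of the overview: the generator of the dilations at t = 1. *)
Definition euler a : T :=
  [ffun w : m.-bseq (letter V) => (size w)%:R * tcoef a w].

Lemma tcoef_euler a w : tcoef (euler a) w = (size w)%:R * tcoef a w.
Proof. by rewrite {1}/tcoef ffunE. Qed.

Lemma eulerD a b : euler (a + b) = euler a + euler b.
Proof. by apply/ttensorP => w; rewrite tcoefD !tcoef_euler tcoefD mulrDr. Qed.

Lemma eulerZ (c : R) a : euler (c *: a) = c *: euler a.
Proof. by apply/ttensorP => w; rewrite tcoefZ !tcoef_euler tcoefZ mulrCA. Qed.

Lemma eulerB a b : euler (a - b) = euler a - euler b.
Proof. by rewrite eulerD -[- b]scaleN1r eulerZ scaleN1r. Qed.

Lemma eulerM a b : euler (a * b) = euler a * b + a * euler b.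
Proof.
apply/ttensorP => w; rewrite tcoef_euler tcoefD !tcoefM mulr_sumr -big_split.
apply: eq_bigr => u _ /=; rewrite mulr_sumr -big_split; apply: eq_bigr => v /eqP e /=.
by rewrite !tcoef_euler -e size_cat natrD mulrDl -mulrA; congr (_ + _); rewrite mulrCA.
Qed.

Lemma euler1 : euler 1 = 0.
Proof.
apply/ttensorP => w; rewrite tcoef_euler tcoef0 tcoef1E.
by case: eqP => [->|]; rewrite ?mul0r ?mulr0.
Qed.

Lemma order_ge_euler k a : order_ge k a -> order_ge k (euler a).
Proof. by move=> ha w wk; rewrite tcoef_euler ha ?mulr0. Qed.

Lemma degree_part_euler k a :
  degree_part k (euler a) = k%:R *: degree_part k a.
Proof.
apply/ttensorP => w; rewrite tcoefZ !tcoef_degree_part tcoef_euler.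
by case: eqP => [->|]; rewrite ?mulr0.
Qed.

Lemma tcoef_dilation (t : R) a w :
  tcoef (dilation t a) w = t ^+ size w * tcoef a w.
Proof. by rewrite {1}/tcoef ffunE. Qed.

Lemma dilationD t a b : dilation t (a + b) = dilation t a + dilation t b.
Proof. by apply/ttensorP => w; rewrite tcoefD !tcoef_dilation tcoefD mulrDr. Qed.

Lemma dilationZ t (c : R) a : dilation t (c *: a) = c *: dilation t a.
Proof. by apply/ttensorP => w; rewrite tcoefZ !tcoef_dilation tcoefZ mulrCA. Qed.

Lemma dilationB t a b : dilation t (a - b) = dilation t a - dilation t b.
Proof. by rewrite dilationD -[- b]scaleN1r dilationZ scaleN1r. Qed.

Lemma dilation_sum t I (r : seq I) (P : pred I) (F : I -> T) :
  dilation t (\sum_(i <- r | P i) F i) = \sum_(i <- r | P i) dilation t (F i).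
Proof.
apply: (big_morph (dilation t)) => [a b|]; first exact: dilationD.
by rewrite -(scale0r 0) dilationZ !scale0r.
Qed.

Lemma dilationM t a b : dilation t (a * b) = dilation t a * dilation t b.
Proof.
apply/ttensorP => w; rewrite tcoef_dilation !tcoefM mulr_sumr.
apply: eq_bigr => u _; rewrite mulr_sumr; apply: eq_bigr => v /eqP e.
by rewrite !tcoef_dilation -e size_cat exprD mulrACA.
Qed.

Lemma dilation1 t : dilation t (1 : T) = 1.
Proof.
apply/ttensorP => w; rewrite tcoef_dilation tcoef1E.
by case: eqP => [->|]; rewrite ?mul1r ?mulr0.
Qed.

Lemma dilationX t a n : dilation t (a ^+ n) = dilation t a ^+ n.
Proof.
by elim: n => [|n IHn]; rewrite ?expr0 ?dilation1 // !exprS dilationM IHn.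
Qed.

Lemma dilation_texp t a : dilation t (texp a) = texp (dilation t a).
Proof.
by rewrite /texp dilation_sum; apply: eq_bigr => k _; rewrite dilationZ dilationX.
Qed.

Lemma dilation_degree_part t k a :
  dilation t (degree_part k a) = t ^+ k *: degree_part k a.
Proof.
apply/ttensorP => w; rewrite tcoef_dilation tcoefZ tcoef_degree_part.
by case: eqP => [->|]; rewrite ?mulr0.
Qed.

End Grading.

(** * Truncated exponentials and the conjugation series *)

Section Exponential.
Variables (R : numFieldType) (V : vectType R) (m : nat).
Local Notation T := (ttensor V m).
Implicit Types (a b g h x y : T).

(** Rearrangement of a Cauchy product; it sorts a product of two exponential series by total
    degree. *)
Lemma sum_triangle (A : nmodType) (F : nat -> nat -> A) n :
  \sum_(0 <= k < n) \sum_(0 <= i < k.+1) F i (k - i)%N =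
  \sum_(0 <= i < n) \sum_(0 <= j < n - i) F i j.
Proof.
elim: n => [|n IHn]; first by rewrite !big_nil.
rewrite [RHS]big_nat_recr //= subSnn big_nat1 big_nat_recr // IHn /=.
rewrite [X in _ + X]big_nat_recr //= subnn addrA; congr (_ + _).
rewrite -big_split /=; apply: eq_big_nat => i /andP[_ lt_in].
by rewrite subSn ?(ltnW lt_in) // big_nat_recr.
Qed.

Definition divided_power a n : T := n`!%:R^-1 *: a ^+ n.

Lemma texpE a : texp a = \sum_(0 <= k < m.+1) divided_power a k.
Proof. by rewrite big_mkord. Qed.

Lemma divided_powerS a n :
  n.+1%:R *: divided_power a n.+1 = a * divided_power a n.
Proof.
rewrite scalerA factS natrM invfM mulrA mulfV ?pnatr_eq0 // mul1r.
by rewrite exprS scalerAr.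
Qed.

Lemma divided_power_comm a n :
  divided_power a n * a = a * divided_power a n.
Proof. by rewrite -scalerAl -exprSr exprS scalerAr. Qed.

Section Conjugation.
Variables (a : T) (f : {linear T -> T}).
Hypothesis a1 : order_ge 1 a.

(** The coefficient of t^n in exp(-ta) f(exp(ta) x). *)
Definition conj_term n x : T :=
  \sum_(0 <= i < n.+1) divided_power (- a) i * f (divided_power a (n - i) * x).

Lemma conj_term0 x : conj_term 0 x = f x.
Proof.
by rewrite /conj_term big_nat1 /divided_power !expr0 invr1 !scale1r !mul1r.
Qed.

(** The derivative in t of exp(-ta) f(exp(ta) x), read on coefficients: up to the factor n + 1, each
    term is the commutator of the previous one with left multiplication by a. *)
Lemma conj_termS n x :
  n.+1%:R *: conj_term n.+1 x = conj_term n (a * x) - a * conj_term n x.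
Proof.
rewrite /conj_term scaler_sumr.
pose F i := divided_power (- a) i * f (divided_power a (n.+1 - i) * x).
(* The weight n + 1 splits as i + (n + 1 - i). The first share lowers the power of -a outside [f],
   the second the power of a inside. *)
transitivity (\sum_(0 <= i < n.+2) i%:R *: F i +
              \sum_(0 <= i < n.+2) (n.+1 - i)%:R *: F i).
  rewrite -big_split /=; apply: eq_big_nat => i /andP[_ i_n].
  by rewrite -scalerDl -natrD subnKC.
rewrite addrC big_nat_recr //= subnn scale0r addr0; congr (_ + _).
  apply: eq_big_nat => i /andP[_ i_n]; rewrite /F scalerAr -linearZ /=.
  rewrite ltnS in i_n.
  by rewrite scalerAl subSn // divided_powerS -divided_power_comm mulrA.
rewrite big_nat_recl //= scale0r add0r mulr_sumr -sumrN.
apply: eq_big_nat => i /andP[_ i_n].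
by rewrite /F scalerAl divided_powerS subSS mulNr mulrA mulNr.
Qed.

Lemma texp_conj x :
  texp (- a) * f (texp a * x) = \sum_(0 <= n < m.+1 + m.+1) conj_term n x.
Proof.
pose F i j := divided_power (- a) i * f (divided_power a j * x).
have Na1 : order_ge 1 (- a) by exact: order_geN.
(* The square of indices at most m lies in the triangle i + j < 2m + 2, and all terms of the
   triangle outside the square vanish by nilpotency. *)
have big0 i j : (m < i)%N || (m < j)%N -> F i j = 0.
  rewrite /F /divided_power; case/orP => ?.
    by rewrite order_ge1_expr // scaler0 mul0r.
  by rewrite (@order_ge1_expr _ _ _ a) // scaler0 mul0r linear0 mulr0.
rewrite [RHS](sum_triangle F) (@big_cat_nat _ _ _ m.+1) //= ?leq_addr //.
rewrite [X in _ + X]big1_seq ?addr0; last first.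
  move=> i; rewrite mem_index_iota => /andP[_ /andP[mi _]].
  by rewrite big1 // => j _; rewrite big0 ?mi.
rewrite !texpE mulr_suml; apply: eq_big_nat => i /andP[_ im].
rewrite mulr_suml linear_sum mulr_sumr.
have mle : (m.+1 <= m.+1 + m.+1 - i)%N by rewrite -addnBA ?leq_addr // ltnW.
rewrite [RHS](@big_cat_nat _ _ _ m.+1) //= [X in _ + X]big1_seq ?addr0 //.
by move=> j; rewrite mem_index_iota => /andP[_ /andP[mj _]]; rewrite big0 ?mj ?orbT.
Qed.

End Conjugation.

(** For f the identity, which commutes with left multiplication by a, the recursion kills every term
    of positive index in the conjugation series. *)
Lemma texpN a : order_ge 1 a -> texp (- a) * texp a = 1.
Proof.
pose idT : {linear T -> T} := idfun.
move=> a1; rewrite -[texp a]mulr1.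
rewrite (texp_conj idT) //.
rewrite big_nat_recl // conj_term0 /= big1 ?addr0 // => n _.
apply: (@scalerI _ _ n.+1%:R); rewrite ?pnatr_eq0 // scaler0.
elim: n (1 : T) => [|n IHn] x; rewrite conj_termS; first by rewrite !conj_term0 subrr.
have e y : conj_term a idT n.+1 y = 0.
  by apply: (@scalerI _ _ n.+1%:R); rewrite ?pnatr_eq0 // scaler0 IHn.
by rewrite !e mulr0 subrr.
Qed.

End Exponential.

(** * Lie elements, logarithmic derivatives and the group structure *)

Section FreeLie.
Variables (R : numFieldType) (V : vectType R) (m : nat).
Local Notation T := (ttensor V m).
Local Notation lie := (@free_lie R V m).
Local Notation G := (@free_nilpotent_group R V m).
Implicit Types (a b g h x y : T) (w : m.-bseq (letter V)) (t : R).

Lemma free_lie0 : lie 0.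
Proof. by rewrite -(scale0r (tvec m 0)); apply/free_lieZ/free_lie_vec. Qed.

Lemma free_lieN a : lie a -> lie (- a).
Proof. by move=> la; rewrite -scaleN1r; exact: free_lieZ. Qed.

Lemma free_lieB a b : lie a -> lie b -> lie (a - b).
Proof. by move=> la lb; apply: free_lieD => //; exact: free_lieN. Qed.

Lemma free_lie_sum I (r : seq I) (P : pred I) (F : I -> T) :
  (forall i, P i -> lie (F i)) -> lie (\sum_(i <- r | P i) F i).
Proof. by move=> hF; apply: big_ind => //; [exact: free_lie0 | exact: free_lieD]. Qed.

Lemma tcoef_tvec (v : V) w : tcoef (tvec m v) w =
  \sum_(i < \dim {:V})
    coord (vbasis {:V}) i v * ((w : seq (letter V)) == [:: i])%:R.
Proof. by rewrite {1}/tcoef ffunE. Qed.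

Lemma tcoef_tvec_eq0 (v : V) w : size w != 1%N -> tcoef (tvec m v) w = 0.
Proof.
move=> w1; rewrite tcoef_tvec big1 // => i _; case: eqP => [e|]; last by rewrite mulr0.
by rewrite e in w1.
Qed.

Lemma degree_part_tvec k (v : V) :
  degree_part k (tvec m v) = if k == 1%N then tvec m v else 0.
Proof.
apply/ttensorP => w; rewrite tcoef_degree_part.
case: eqP => [<-|wk]; case: eqP => // k1.
- by rewrite tcoef_tvec_eq0 ?tcoef0 //; apply/eqP.
- by rewrite tcoef_tvec_eq0 // -k1; apply/eqP.
- by rewrite tcoef0.
Qed.

Lemma free_lie_order_ge1 a : lie a -> order_ge 1 a.
Proof.
elim=> [v w|{}a b _ ha _ hb|c {}a _ ha|{}a b _ ha _ hb].
- by move=> w0; rewrite tcoef_tvec_eq0 // ltn_eqF.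
- exact: order_geD.
- exact: order_geZ.
- by apply: order_geB; apply: (@order_geW _ _ _ 1 2) => //; exact: (@order_geM _ _ _ 1 1).
Qed.

Lemma free_lie_degree_part k a : lie a -> lie (degree_part k a).
Proof.
move=> la; elim: la k => [v|{}a b _ ha _ hb|c {}a _ ha|{}a b _ ha _ hb] k.
- by rewrite degree_part_tvec; case: ifP => _; [exact: free_lie_vec | exact: free_lie0].
- by rewrite degree_partD; exact: free_lieD.
- by rewrite degree_partZ; exact: free_lieZ.
- rewrite degree_partB !degree_partM.
  rewrite [X in _ - X](reindex_inj rev_ord_inj) -sumrB; apply: free_lie_sum => i _ /=.
  by rewrite subSS subKn -1?ltnS //; exact: free_lie_bracket.
Qed.

Lemma euler_tvec (v : V) : euler (tvec m v) = tvec m v.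
Proof.
apply/ttensorP => w; rewrite tcoef_euler; have [->|w1] := eqVneq (size w) 1%N.
  by rewrite mul1r.
by rewrite tcoef_tvec_eq0 // mulr0.
Qed.

Lemma free_lie_euler a : lie a -> lie (euler a).
Proof.
elim=> [v|{}a b _ ha _ hb|c {}a _ ha|{}a b la ha lb hb].
- by rewrite euler_tvec; exact: free_lie_vec.
- by rewrite eulerD; exact: free_lieD.
- by rewrite eulerZ; exact: free_lieZ.
- rewrite eulerB !eulerM [euler b * a + _]addrC opprD addrACA.
  by apply: free_lieD; exact: free_lie_bracket.
Qed.

Lemma dilation_tvec t (v : V) : dilation t (tvec m v) = t *: tvec m v.
Proof.
apply/ttensorP => w; rewrite tcoef_dilation tcoefZ.
have [->|w1] := eqVneq (size w) 1%N; first by rewrite expr1.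
by rewrite tcoef_tvec_eq0 // !mulr0.
Qed.

Lemma free_lie_dilation t a : lie a -> lie (dilation t a).
Proof.
elim=> [v|{}a b _ ha _ hb|c {}a _ ha|{}a b _ ha _ hb].
- by rewrite dilation_tvec; exact/free_lieZ/free_lie_vec.
- by rewrite dilationD; exact: free_lieD.
- by rewrite dilationZ; exact: free_lieZ.
- by rewrite dilationB !dilationM; exact: free_lie_bracket.
Qed.

(** Apart from r itself, each monomial of exp(a + r) - exp(a) contains r and at least one more
    factor of order 1. *)
Lemma texp_perturb k a r : (0 < k)%N -> order_ge 1 a -> order_ge k r ->
  order_ge k.+1 (texp (a + r) - texp a - r).
Proof.
move=> k0 a1 rk; have r1 : order_ge 1 r by exact: order_geW rk.
have texp_ext x : order_ge 1 x ->
    texp x = 1 + x + \sum_(0 <= n < m) divided_power x n.+2.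
  move=> x1; rewrite texpE.
  (* Adding the vanishing power m + 1 allows degrees 0 and 1 to be split off even if m = 0. *)
  transitivity (\sum_(0 <= n < m.+2) divided_power x n).
    by rewrite [RHS]big_nat_recr //= /divided_power order_ge1_expr // scaler0 addr0.
  rewrite !big_nat_recl // addrA /divided_power expr0 expr1.
  by rewrite fact0 factS fact0 muln1 invr1 !scale1r.
have pow n : order_ge (k + n) ((a + r) ^+ n.+1 - a ^+ n.+1).
  elim: n => [|n IHn]; first by rewrite !expr1 addrC addKr addn0.
  have -> : (a + r) ^+ n.+2 - a ^+ n.+2 =
      (a + r) * ((a + r) ^+ n.+1 - a ^+ n.+1) + r * a ^+ n.+1.
    rewrite mulrBr -exprS addrAC -addrA; congr (_ + _).
    by rewrite mulrDl opprD [a ^+ n.+2]exprS addrCA subrr addr0.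
  apply: order_geD; last by apply: order_geM => //; exact: order_geX.
  by rewrite addnS -add1n; apply: order_geM IHn; exact: order_geD.
rewrite !texp_ext //; last exact: order_geD.
set S1 := \sum_(_ <= _ < _) _; set S2 := \sum_(_ <= _ < _) _.
have -> : 1 + (a + r) + S1 - (1 + a + S2) - r = S1 - S2.
  rewrite (addrA 1 a) -(addrA (1 + a)) opprD addrACA subrr add0r.
  by rewrite -(addrA r) [r + _]addrC addrK.
rewrite -sumrB; apply: order_ge_sum => n _; rewrite -scalerBr.
by apply/order_geZ/(order_geW _ (pow n.+1)); rewrite addnS ltnS leq_addr.
Qed.

Lemma texp0 : texp (0 : T) = 1.
Proof.
rewrite texpE big_nat_recl // /divided_power expr0 fact0 invr1 scale1r.
by rewrite big1 ?addr0 // => n _; rewrite expr0n scaler0.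
Qed.

Lemma order_ge_texp_sub1 a : order_ge 1 a -> order_ge 1 (texp a - 1).
Proof.
move=> a1; have := texp_perturb (isT : 0 < 1)%N (@order_ge0 _ _ _ 1) a1.
rewrite add0r texp0 => h; rewrite -[texp a - 1](subrK a).
by apply: order_geD => //; exact: order_geW h.
Qed.

(** Once a has order j > 0, exp(a) - 1 - a has order j + 1, so a gains one order as long as exp(a) -
    1 has it. *)
Lemma texp_sub1_order_ge k a :
  order_ge 1 a -> order_ge k (texp a - 1) -> order_ge k a.
Proof.
move=> a1 ek; suff: forall j, (j <= k)%N -> order_ge j a by apply.
elim=> [|j IHj] jk; first by [].
have [->|j0] := posnP j; first by [].
have := texp_perturb j0 (@order_ge0 _ _ _ 1) (IHj (ltnW jk)).
rewrite add0r texp0 => h; rewrite -[a](subKr (texp a - 1)).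
by apply: order_geB => //; exact: order_geW ek.
Qed.

(** The commutator of the left multiplications by z and a is left multiplication by [z, a], so the
    recursion produces iterated brackets. The starting index is 0 for f a left multiplication and 1
    for the Euler derivation. *)
Lemma conj_term_lie a (f : {linear T -> T}) y k : lie a -> lie y ->
    (forall x, conj_term a f k x = y * x) ->
  forall n, exists2 z, lie z & forall x, conj_term a f (k + n) x = z * x.
Proof.
move=> la ly fy; elim=> [|n [z lz fz]]; first by exists y => // x; rewrite addn0.
exists ((k + n).+1%:R^-1 *: (z * a - a * z)).
  exact/free_lieZ/free_lie_bracket.
move=> x; rewrite addnS; apply: (@scalerI _ _ (k + n).+1%:R).
  by rewrite pnatr_eq0.
rewrite conj_termS !fz -scalerAl scalerA mulfV ?pnatr_eq0 // scale1r.
by rewrite mulrBl !mulrA.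
Qed.

Lemma free_lie_texp_conj a y :
  lie a -> lie y -> lie (texp (- a) * y * texp a).
Proof.
move=> la ly; pose f : {linear T -> T} := y \*o idfun.
have := @texp_conj _ _ _ a f (free_lie_order_ge1 la) 1.
rewrite mulr1 /= mulrA => ->; apply: free_lie_sum => n _.
have [x|z lz e] := conj_term_lie (f := f) (k := 0) la ly _ n; first by rewrite conj_term0.
by rewrite -[n]add0n e mulr1.
Qed.

Lemma euler_is_linear : linear (@euler R V m).
Proof. by move=> c x y; rewrite eulerD eulerZ. Qed.

HB.instance Definition _ :=
  GRing.isLinear.Build R T T _ (@euler R V m) euler_is_linear.

(** The conjugation series of E is evaluated at 1: its term of index 0 is E 1 = 0, and its term of
    index 1 is left multiplication by E a, since E is a derivation. *)
Lemma free_lie_texp_euler a : lie a -> lie (texp (- a) * euler (texp a)).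
Proof.
move=> la; pose f : {linear T -> T} := @euler R V m.
have := @texp_conj _ _ _ a f (free_lie_order_ge1 la) 1.
rewrite mulr1 /= => ->; rewrite addSn big_nat_recl // conj_term0 /= euler1 add0r.
apply: free_lie_sum => n _.
have [x|z lz e] := conj_term_lie (f := f) (k := 1) la (free_lie_euler la) _ n.
  have := conj_termS a f 0 x; rewrite scale1r !conj_term0 /= => ->.
  by rewrite eulerM addrK.
by rewrite -add1n e mulr1.
Qed.

Lemma texp_unit a : order_ge 1 a -> texp a \is a GRing.unit.
Proof.
move=> a1; apply/unitrP; exists (texp (- a)); split; first exact: texpN.
by rewrite -{1}[a]opprK texpN //; exact: order_geN.
Qed.

Lemma texpV a : order_ge 1 a -> (texp a)^-1 = texp (- a).
Proof.
by move=> a1; apply: (mulIr (texp_unit a1)); rewrite mulVr ?texp_unit // texpN.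
Qed.

(* Successive approximation: if [g] and [exp a] agree below degree [n + 1],
   comparing the equations [E g = g xi] and [E (exp a) = exp a eta] in degree
   [n + 1] shows that their difference there is a Lie element. *)
Lemma group_log_derivative g xi : order_ge 1 (g - 1) -> lie xi ->
  euler g = g * xi -> G g.
Proof.
move=> g1 lxi gxi.
suff /(_ m)[a la /order_ge_eq0/eqP] : forall n, exists2 a, lie a & order_ge n.+1 (g - texp a).
  by rewrite subr_eq0 => /eqP e; exists a.
elim=> [|n [a la ga]]; first by exists 0; [exact: free_lie0 | rewrite texp0].
have a1 := free_lie_order_ge1 la.
have xi1 := free_lie_order_ge1 lxi.
pose eta := texp (- a) * euler (texp a); have leta := free_lie_texp_euler la.
pose r := degree_part n.+1 (g - texp a).
have aeta : euler (texp a) = texp a * eta.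
  by rewrite mulrA -texpV // divrr ?texp_unit // mul1r.
have e : euler (g - texp a) = (g - texp a) * xi + texp a * (xi - eta).
  by rewrite eulerB gxi aeta mulrBl mulrBr addrA subrK.
have ord1 : order_ge n.+2 ((g - texp a) * xi).
  by rewrite -addn1; exact: order_geM.
(* By [e], exp(a) (xi - eta) has order n + 1, and exp(a) is invertible. *)
have ord2 : order_ge n.+1 (xi - eta).
  rewrite -[xi - eta]mul1r -(texpN a1) -mulrA -[n.+1]add0n.
  apply: order_geM => //.
  have -> : texp a * (xi - eta) = euler (g - texp a) - (g - texp a) * xi.
    by rewrite e addrAC subrr add0r.
  by apply: order_geB; [exact: order_ge_euler | exact: order_geW ord1].
have er : n.+1%:R *: r = degree_part n.+1 (xi - eta).
  rewrite /r -degree_part_euler e [LHS]degree_partD (degree_part_order_ge ord1) add0r.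
  have ord3 : order_ge n.+2 ((texp a - 1) * (xi - eta)).
    by rewrite -add1n; apply: order_geM => //; exact: order_ge_texp_sub1.
  rewrite -{1}[texp a](subrK 1) mulrDl mul1r [LHS]degree_partD.
  by rewrite (degree_part_order_ge ord3) add0r.
have lr : lie r.
  rewrite -[r]scale1r -(@mulVf _ n.+1%:R) ?pnatr_eq0 // -scalerA er.
  by apply/free_lieZ/free_lie_degree_part/free_lieB.
exists (a + r); first exact: free_lieD.
have -> : g - texp (a + r) = (g - texp a - r) - (texp (a + r) - texp a - r).
  by rewrite opprB addrA subrK opprB addrA subrK.
apply: order_geB; first exact: order_geS.
by apply: texp_perturb => //; exact: order_ge_degree_part.
Qed.

Lemma group_texp a : lie a -> G (texp a).
Proof. by move=> la; exists a. Qed.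

Lemma group_unit g : G g -> g \is a GRing.unit.
Proof. by case=> a la <-; exact/texp_unit/free_lie_order_ge1. Qed.

Lemma group1 : G 1.
Proof. by rewrite -texp0; exact/group_texp/free_lie0. Qed.

Lemma groupV g : G g -> G g^-1.
Proof.
case=> a la <-; rewrite texpV; last exact: free_lie_order_ge1.
exact/group_texp/free_lieN.
Qed.

Lemma group_sub1 g : G g -> order_ge 1 (g - 1).
Proof. by case=> a la <-; exact/order_ge_texp_sub1/free_lie_order_ge1. Qed.

(** The logarithmic derivative of the product is a conjugated Lie element plus a Lie element; this
    replaces the Baker-Campbell-Hausdorff formula. *)
Lemma groupM g h : G g -> G h -> G (g * h).
Proof.
move=> [a la <-] [b lb <-]; have b1 := free_lie_order_ge1 lb.
have a1 := free_lie_order_ge1 la.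
apply: (@group_log_derivative _ (texp (- b) * (texp (- a) * euler (texp a)) * texp b
                           + texp (- b) * euler (texp b))).
- have -> : texp a * texp b - 1 = (texp a - 1) * texp b + (texp b - 1).
    by rewrite mulrBl mul1r addrA subrK.
  apply: order_geD; last exact: order_ge_texp_sub1.
  by apply: (@order_geM _ _ _ 1 0) => //; exact: order_ge_texp_sub1.
- apply: free_lieD; last exact: free_lie_texp_euler.
  by apply: free_lie_texp_conj => //; exact: free_lie_texp_euler.
- rewrite eulerM mulrDr -!texpV // !mulrA mulrK ?texp_unit //.
  by rewrite divrr ?texp_unit // mul1r.
Qed.

Lemma group_dilation t g : G g -> G (dilation t g).
Proof.
by case=> a la <-; rewrite dilation_texp; exact/group_texp/free_lie_dilation.
Qed.

Lemma dilationV t g : G g -> dilation t g^-1 = (dilation t g)^-1.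
Proof.
move=> Gg; apply: (mulIr (group_unit (group_dilation t Gg))).
rewrite mulVr; last exact/group_unit/group_dilation.
by rewrite -dilationM mulVr ?dilation1 //; exact: group_unit.
Qed.

End FreeLie.

(** * Seminorms, subspaces and compactness in finite dimension *)

Section CoordinateSpace.
Variables (R : realType) (I : finType).
Local Notation E := {ffun I -> R^o}.
Implicit Types (x y z : E).

Definition l1norm x : R := \sum_i `|x i|.

Lemma l1norm_ge0 x : 0 <= l1norm x.
Proof. exact: sumr_ge0. Qed.

Lemma l1normD x y : l1norm (x + y) <= l1norm x + l1norm y.
Proof.
rewrite /l1norm -big_split /=; apply: ler_sum => i _.
by rewrite ffunE ler_normD.
Qed.

Lemma l1normZ (c : R) x : l1norm (c *: x) = `|c| * l1norm x.
Proof. by rewrite mulr_sumr; apply: eq_bigr => i _; rewrite ffunE normrM. Qed.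

Lemma l1normN x : l1norm (- x) = l1norm x.
Proof. by rewrite -scaleN1r l1normZ normrN1 mul1r. Qed.

Lemma l1norm_distC x y : l1norm (x - y) = l1norm (y - x).
Proof. by rewrite -l1normN opprB. Qed.

Lemma l1norm0 : l1norm 0 = 0.
Proof. by rewrite /l1norm big1 // => i _; rewrite ffunE normr0. Qed.

Lemma ler_coord_l1norm x i : `|x i| <= l1norm x.
Proof. by rewrite /l1norm (bigD1 i) //= lerDl sumr_ge0. Qed.

Lemma l1norm_eq0 x : l1norm x = 0 -> x = 0.
Proof.
move=> x0; apply/ffunP => i; rewrite ffunE; apply/eqP; rewrite -normr_le0 -x0.
exact: ler_coord_l1norm.
Qed.

Lemma l1norm_sum J (r : seq J) (P : pred J) (F : J -> E) :
  l1norm (\sum_(j <- r | P j) F j) <= \sum_(j <- r | P j) l1norm (F j).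
Proof.
elim/big_ind2: _ => [|x1 y1 x2 y2 h1 h2|//]; first by rewrite l1norm0.
by apply: le_trans (l1normD _ _) _; exact: lerD.
Qed.

Lemma seminorm_ge0 (N : E -> R) :
    (forall x y, N (x + y) <= N x + N y) ->
    (forall (c : R) x, N (c *: x) = `|c| * N x) ->
  forall x, 0 <= N x.
Proof.
move=> ND NZ x; have := ND x (- x).
rewrite subrr -(scale0r (0 : E)) NZ normr0 mul0r -scaleN1r NZ normrN1 mul1r.
by rewrite -mulr2n pmulrn_lge0.
Qed.

(** Expansion on the Dirac functions. Stated for seminorms so that it also applies to distances to a
    subspace and to coordinate functionals. *)
Lemma seminorm_le_l1norm (N : E -> R) :
    (forall x y, N (x + y) <= N x + N y) ->
    (forall (c : R) x, N (c *: x) = `|c| * N x) ->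
  exists2 C, 0 <= C & forall x, N x <= C * l1norm x.
Proof.
move=> ND NZ.
have Nge0 := seminorm_ge0 ND NZ.
have N0 : N 0 = 0 by rewrite -(scale0r (0 : E)) NZ normr0 mul0r.
pose dirac i : E := [ffun j => (j == i)%:R].
exists (\sum_i N (dirac i)) => [|x]; first exact: sumr_ge0.
have {1}-> : x = \sum_i x i *: dirac i.
  apply/ffunP => j; rewrite sum_ffunE (bigD1 j) //= big1 ?addr0 => [|i ij].
    by rewrite !ffunE eqxx [RHS]mulr1.
  by rewrite !ffunE eq_sym (negPf ij) [LHS]mulr0.
have Nsum : N (\sum_i x i *: dirac i) <= \sum_i N (x i *: dirac i).
  elim/big_ind2: _ => [|x1 y1 x2 y2 h1 h2|//]; first by rewrite N0.
  by apply: le_trans (ND _ _) _; exact: lerD.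
apply: le_trans Nsum _; rewrite mulr_suml; apply: ler_sum => i _.
by rewrite NZ mulrC ler_wpM2l // ler_coord_l1norm.
Qed.

Section Subspace.
Variable P : E -> Prop.
Hypotheses (P0 : P 0) (PD : forall x y, P x -> P y -> P (x + y))
  (PZ : forall (c : R) x, P x -> P (c *: x)).

(** A subspace of maximal dimension among those contained in [P] absorbs every line spanned by an
    element of [P]. This gives the inductively defined Lie elements a basis and a projection. *)
Lemma subspace_vspace : exists U : {vspace E}, forall x, P x <-> x \in U.
Proof.
pose Q n := `[< exists U : {vspace E}, \dim U = n /\ forall x, x \in U -> P x >].
have exQ : exists n, Q n.
  exists 0%N; apply/asboolP; exists 0%VS; split; first exact: dimv0.
  by move=> x; rewrite memv0 => /eqP ->.
have ubQ n : Q n -> (n <= \dim {:E})%N.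
  by move=> /asboolP[U [<- _]]; exact/dimvS/subvf.
case: (ex_maxnP exQ ubQ) => d /asboolP[U [dU UP]] maxd.
exists U => x; split=> [Px|]; last exact: UP.
have : Q (\dim (U + <[x]>)%VS).
  apply/asboolP; exists (U + <[x]>)%VS; split => // _ /memv_addP[u Uu [_ /vlineP[c ->] ->]].
  by apply: PD; [exact: UP | exact: PZ].
move=> /maxd; rewrite -dU => le_d; have /eqP -> : U == (U + <[x]>)%VS.
  by rewrite eqEdim addvSl.
exact: (subvP (addvSr _ _)) (memv_line x).
Qed.

(** The seminorm |x - proj x| vanishes on [P] and is bounded by a multiple of the l1 norm, hence
    vanishes at limits of elements of [P]. *)
Lemma subspace_closed z :
  (forall e, 0 < e -> exists2 x, P x & l1norm (x - z) < e) -> P z.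
Proof.
move=> hz; have [U PU] := subspace_vspace; apply/PU.
pose N x := l1norm (x - projv U x).
have [x y|c x|C C0 NC] := @seminorm_le_l1norm N.
- rewrite /N linearD opprD addrACA; exact: l1normD.
- by rewrite /N linearZ -scalerBr l1normZ.
have NzE e : 0 < e -> N z <= C * e.
  move=> /hz[x /PU Ux xz]; apply: (@le_trans _ _ (N (z - x))).
    rewrite /N linearB /= (projv_id Ux).
    by rewrite opprB addrA subrK lexx.
  by apply: le_trans (NC _) _; rewrite ler_wpM2l // l1norm_distC ltW.
have Nz0 : N z = 0.
  apply/eqP; rewrite eq_le l1norm_ge0 andbT; apply/ler_addgt0Pr => e e0.
  (* The summand 1 keeps the denominator positive when C = 0. *)
  rewrite add0r; apply: le_trans (NzE (e / (C + 1)) _) _.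
    by rewrite divr_gt0 // ltr_wpDl.
  by rewrite mulrCA ger_pMr // ler_pdivrMr ?ltr_wpDl // mul1r lerDl.
by have /subr0_eq -> := l1norm_eq0 Nz0; exact: memv_proj.
Qed.

(** The coordinates in a basis of the subspace extend to linear forms on the whole space, and are
    therefore bounded. *)
Lemma subspace_coordinates : exists n (b : 'I_n -> E) (c : 'I_n -> E -> R) C,
  [/\ forall i, P (b i), 0 <= C,
      forall x, P x -> x = \sum_(i < n) c i x *: b i
    & forall i x, `|c i x| <= C * l1norm x].
Proof.
have [U PU] := subspace_vspace.
pose c (i : 'I_(\dim U)) x : R := coord (vbasis U) i x.
have cC i : exists C : R, 0 <= C /\ forall x, `|c i x| <= C * l1norm x.
  have [x y|a x|C C0 hC] := @seminorm_le_l1norm (fun x => `|c i x|).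
  - by rewrite /c linearD ler_normD.
  - by rewrite /c linearZ normrM.
  by exists C.
have [C hC] := choice cC.
exists (\dim U), (fun i => (vbasis U)`_i), c, (\sum_i C i); split.
- by move=> i; apply/PU/vbasis_mem/mem_nth; rewrite size_tuple.
- by apply: sumr_ge0 => i _; case: (hC i).
- by move=> x /PU Ux; rewrite {1}(coord_vbasis Ux).
- move=> i x; apply: (le_trans ((hC i).2 x)); rewrite ler_wpM2r ?l1norm_ge0 //.
  by rewrite (bigD1 i) //= lerDl sumr_ge0 // => j _; case: (hC j).
Qed.

End Subspace.

Import ArrowAsProduct.
Local Open Scope classical_set_scope.

(** A positive lower semicontinuous function on a closed bounded set is bounded away from 0:
    otherwise points with [F] below 1/(n + 1) would cluster at a point of [P] where [F] is at most
    0. *)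
Lemma compact_lower_bound (P : E -> Prop) (F : E -> R) (M : R) :
    (forall x, P x -> l1norm x <= M) ->
    (forall z, (forall e, 0 < e -> exists2 x, P x & l1norm (x - z) < e) -> P z) ->
    (forall x, P x -> 0 < F x) ->
    (forall z, P z -> forall e, 0 < e -> exists2 d, 0 < d &
       forall x, P x -> l1norm (x - z) < d -> F z <= F x + e) ->
  exists2 c, 0 < c & forall x, P x -> c <= F x.
Proof.
move=> PM Pcl F0 Flsc; apply: contrapT => nc.
have small n : exists x, P x /\ F x < n.+1%:R^-1.
  apply: contrapT => hn; apply: nc; exists n.+1%:R^-1; first by rewrite invr_gt0.
  move=> x Px; rewrite leNgt; apply/negP => lt_x.
  by apply: hn; exists x.
have [u hu] := choice small.
pose v n : I -> R := u n.
(* The cluster point is found among plain functions with the product topology, where Tychonoff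
   applies to the cube. *)
have cK : compact [set f : I -> R | forall i, `[- M, M]%classic (f i)].
  exact: (@tychonoff I (fun=> R) (fun=> `[- M, M]%classic) (fun=> @segment_compact R (- M) M)).
have [|p [_ clp]] := cK (v @ \oo) _.
  exists 0%N => // n _ i /=; rewrite in_itv /= -ler_norml.
  by apply: le_trans (PM _ (hu n).1); exact: ler_coord_l1norm.
pose z : E := [ffun i => p i].
have near_z e n0 : 0 < e -> exists2 n, (n0 <= n)%N & l1norm (u n - z) < e.
  (* Summing over the coordinates gives at most #|I| d, which the successor makes strictly less than
     e. *)
  move=> e0; pose d := e / #|I|.+1%:R.
  have d0 : 0 < d by rewrite divr_gt0.
  have vA : (v @ \oo) [set f | exists2 n, (n0 <= n)%N & f = v n].
    by exists n0 => // n /= n0n; exists n.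
  have pB : nbhs p [set f : I -> R | forall i, `|p i - f i| < d].
    apply: (@filter_forall _ I (fun i (f : I -> R) => `|p i - f i| < d) (nbhs p)) => i.
    have := @proj_continuous I (fun=> R) i p.
    by move=> /cvgr_dist_lt/(_ d d0).
  have [_ [[n n0n ->] vn]] := clp _ _ vA pB.
  exists n => //; apply: (@le_lt_trans _ _ (\sum_(i : I) d)).
    by apply: ler_sum => i _; rewrite !ffunE distrC ltW.
  rewrite sumr_const -mulr_natr /d -mulrA gtr_pMr // mulrC.
  by rewrite ltr_pdivrMr // mul1r ltr_nat.
have Pz : P z.
  apply: Pcl => e /(near_z _ 0%N)[n _ nz]; exists (u n) => //; exact: (hu n).1.
have : F z <= 0.
  apply/ler_addgt0Pr => e e0; rewrite add0r.
  have [d d0 hd] := Flsc z Pz (e / 2) (divr_gt0 e0 (ltr0Sn _ 1)).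
  (* The index is taken so late that 1/(n + 1) is at most e / 2. *)
  have [n en nz] := near_z d (Num.truncn (e / 2)^-1) d0.
  apply: le_trans (hd _ (hu n).1 nz) _.
  rewrite [leRHS]splitr lerD2r; apply: le_trans (ltW (hu n).2) _.
  rewrite invf_ple ?posrE ?divr_gt0 //; apply: ltW.
  apply: lt_le_trans (truncnS_gt _) _.
  by rewrite ler_nat ltnS.
by move=> /(lt_le_trans (F0 _ Pz)); rewrite ltxx.
Qed.

(** [N] has a positive lower bound on the l1 unit sphere; homogeneity extends it to all vectors. *)
Lemma l1norm_le_norm (N : E -> R) : is_norm N ->
  exists2 C, 0 <= C & forall x, l1norm x <= C * N x.
Proof.
move=> [ND NZ N0].
have [C C0 NC] := seminorm_le_l1norm ND NZ.
have Nge0 := seminorm_ge0 ND NZ.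
have [||||c c0 hc] := @compact_lower_bound (fun x => l1norm x = 1) N 1.
- by move=> x ->.
- move=> z hz; apply/eqP; rewrite eq_le; apply/andP.
  split; apply/ler_addgt0Pr => e /hz[x x1 /ltW xz].
    rewrite -x1 -[z in leLHS](subrK x) addrC; apply: le_trans (l1normD _ _) _.
    by rewrite lerD2l l1norm_distC.
  rewrite -x1 -[x in leLHS](subrK z) addrC; apply: le_trans (l1normD _ _) _.
  by rewrite lerD2l.
- move=> x x1; rewrite lt_neqAle Nge0 andbT eq_sym; apply/eqP => /N0 x0.
  by move: x1; rewrite x0 l1norm0 => /eqP; rewrite eq_sym oner_eq0.
- move=> z _ e e0; exists (e / (C + 1)); first by rewrite divr_gt0 // ltr_wpDl.
  move=> x _ /ltW xz; rewrite -[z in leLHS](subrK x) addrC.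
  apply: le_trans (ND _ _) _; rewrite lerD2l; apply: le_trans (NC _) _.
  rewrite l1norm_distC; apply: (@le_trans _ _ (C * (e / (C + 1)))).
    exact: ler_wpM2l.
  by rewrite mulrCA ger_pMr // ler_pdivrMr ?ltr_wpDl // mul1r lerDl.
exists c^-1; first by rewrite invr_ge0 ltW.
move=> x; have [x0|x0] := eqVneq (l1norm x) 0.
  by rewrite x0 mulr_ge0 ?invr_ge0 ?(ltW c0).
have xgt0 : 0 < l1norm x by rewrite lt_neqAle eq_sym x0 l1norm_ge0.
have := hc ((l1norm x)^-1 *: x).
rewrite l1normZ NZ ger0_norm ?invr_ge0 ?l1norm_ge0 // mulVf // => /(_ erefl).
by rewrite ler_pdivlMl // mulrC => h; rewrite ler_pdivlMl.
Qed.

End CoordinateSpace.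

Lemma mulr_sub1 (A : pzRingType) (x y : A) :
  x * y - 1 = (x - 1) + (y - 1) + (x - 1) * (y - 1).
Proof.
rewrite -[in LHS](subrK 1 x) -[in LHS](subrK 1 y).
move: (x - 1) (y - 1) => u v.
by rewrite mulrDl mulrDr mulr1 mul1r !addrA addrK -addrA addrC.
Qed.

(** * A submultiplicative norm on the truncated tensor algebra *)

Section TensorNorm.
Variables (R : realType) (V : vectType R) (m : nat).
Local Notation T := (ttensor V m).
Local Notation lie := (@free_lie R V m).
Local Notation G := (@free_nilpotent_group R V m).
Implicit Types (a b g h x y : T) (w : m.-bseq (letter V)) (t : R).

Definition tnorm g : R := @l1norm R (m.-bseq (letter V)) g.

Lemma tnormE g : tnorm g = \sum_w `|tcoef g w|.
Proof. by []. Qed.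

Lemma tnorm_ge0 g : 0 <= tnorm g.
Proof. exact: l1norm_ge0. Qed.

Lemma tnormD g h : tnorm (g + h) <= tnorm g + tnorm h.
Proof. exact: l1normD. Qed.

Lemma tnormZ (c : R) g : tnorm (c *: g) = `|c| * tnorm g.
Proof. exact: l1normZ. Qed.

Lemma tnormN g : tnorm (- g) = tnorm g.
Proof. exact: l1normN. Qed.

Lemma tnorm_distC g h : tnorm (g - h) = tnorm (h - g).
Proof. by rewrite -tnormN opprB. Qed.

Lemma tnorm0 : tnorm 0 = 0.
Proof. exact: l1norm0. Qed.

Lemma ler_tcoef_tnorm g w : `|tcoef g w| <= tnorm g.
Proof. exact: ler_coord_l1norm. Qed.

Lemma tnorm_sum J (r : seq J) (P : pred J) (F : J -> T) :
  tnorm (\sum_(j <- r | P j) F j) <= \sum_(j <- r | P j) tnorm (F j).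
Proof. exact: l1norm_sum. Qed.

Lemma tnorm1 : tnorm 1 = 1.
Proof.
rewrite tnormE (bigD1 [bseq]) //= tcoef1E eqxx normr1 big1 ?addr0 // => w.
by rewrite tcoef1E => /negPf ->; rewrite normr0.
Qed.

(** A pair of words contributes to at most one word, its concatenation, and to none if that is
    longer than m. *)
Lemma tnormM g h : tnorm (g * h) <= tnorm g * tnorm h.
Proof.
rewrite {1}tnormE; apply: (@le_trans _ _ (\sum_(w : m.-bseq (letter V))
  \sum_(u : m.-bseq (letter V)) \sum_(v : m.-bseq (letter V) | u ++ v == w :> seq _)
  `|tcoef g u| * `|tcoef h v|)).
  apply: ler_sum => w _; rewrite tcoefM; apply: le_trans (ler_norm_sum _ _ _) _.
  apply: ler_sum => u _; apply: le_trans (ler_norm_sum _ _ _) _.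
  by apply: ler_sum => v _; rewrite normrM.
rewrite exchange_big /= tnormE mulr_suml; apply: ler_sum => u _.
under eq_bigr do rewrite big_mkcond.
rewrite exchange_big /= tnormE mulr_sumr; apply: ler_sum => v _.
rewrite -big_mkcond /=.
have [uvm|muv] := leqP (size (u ++ v)) m.
  have e : (fun w : m.-bseq (letter V) => u ++ v == w) =1 pred1 (Bseq uvm).
    by move=> w; apply/idP/idP => /eqP e; apply/eqP; [exact/val_inj/esym | rewrite e].
  by rewrite (big_pred1 _ e).
rewrite big_pred0 => [|w]; first exact: mulr_ge0.
by apply/eqP => e; move: muv; rewrite e ltnNge size_bseq.
Qed.

Lemma tnormX_le g M n : 1 <= M -> tnorm g <= M -> tnorm (g ^+ n) <= M ^+ n.
Proof.
move=> M1 gM; elim: n => [|n IHn]; first by rewrite !expr0 tnorm1.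
by rewrite !exprS; apply: le_trans (tnormM _ _) _; rewrite ler_pM ?tnorm_ge0.
Qed.

Lemma tnormX_lipschitz a b M n : 1 <= M -> tnorm a <= M -> tnorm b <= M ->
  tnorm (a ^+ n - b ^+ n) <= n%:R * M ^+ n * tnorm (a - b).
Proof.
move=> M1 aM bM; have M0 : 0 <= M by exact: le_trans M1.
elim: n => [|n IHn]; first by rewrite !expr0 subrr tnorm0 !mul0r.
have -> : a ^+ n.+1 - b ^+ n.+1 = a * (a ^+ n - b ^+ n) + (a - b) * b ^+ n.
  by rewrite !exprS mulrBr mulrBl addrA subrK.
apply: le_trans (tnormD _ _) _; rewrite -natr1 -mulrA [leRHS]mulrDl mul1r mulrA.
apply: lerD.
  apply: le_trans (tnormM _ _) _; rewrite exprS mulrCA -mulrA.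
  exact: ler_pM (tnorm_ge0 _) (tnorm_ge0 _) aM IHn.
apply: le_trans (tnormM _ _) _; rewrite mulrC ler_wpM2r ?tnorm_ge0 //.
apply: le_trans (tnormX_le n M1 bM) _.
by rewrite exprS ler_peMl // exprn_ge0.
Qed.

Lemma texp_lipschitz M : exists2 L, 0 <= L & forall a b,
  tnorm a <= M -> tnorm b <= M -> tnorm (texp a - texp b) <= L * tnorm (a - b).
Proof.
(* The Lipschitz bound on powers requires a radius of at least 1. *)
pose M1 := Num.max M 1; have M11 : 1 <= M1 by rewrite le_max lexx orbT.
have M10 : 0 <= M1 by exact: le_trans M11.
exists (\sum_(k < m.+1) k`!%:R^-1 * (k%:R * M1 ^+ k)).
  by apply: sumr_ge0 => k _; rewrite !mulr_ge0 ?invr_ge0 ?exprn_ge0.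
move=> a b aM bM; rewrite /texp -sumrB mulr_suml.
apply: le_trans (tnorm_sum _ _ _) _; apply: ler_sum => k _.
rewrite -scalerBr tnormZ ger0_norm ?invr_ge0 // -mulrA ler_wpM2l ?invr_ge0 //.
by apply: tnormX_lipschitz => //; rewrite le_max ?aM ?bM.
Qed.

Lemma texp_bounded M : exists2 B, 0 <= B & forall a,
  tnorm a <= M -> tnorm (texp a) <= B.
Proof.
have [L L0 hL] := texp_lipschitz (Num.max M 0).
exists (L * Num.max M 0 + 1) => [|a aM].
  by rewrite addr_ge0 // mulr_ge0 // le_max lexx orbT.
rewrite -[texp a](subrK 1); apply: le_trans (tnormD _ _) _.
rewrite tnorm1 lerD2r -(@texp0 R V m).
have aM0 : tnorm a <= Num.max M 0 by rewrite le_max aM.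
apply: le_trans (hL _ _ aM0 _) _; first by rewrite tnorm0 le_max lexx orbT.
by rewrite subr0 ler_wpM2l.
Qed.

Lemma tnorm_dilation t g : 1 <= t -> tnorm (dilation t g) <= t ^+ m * tnorm g.
Proof.
move=> t1; rewrite !tnormE mulr_sumr; apply: ler_sum => w _.
rewrite tcoef_dilation normrM ger0_norm ?exprn_ge0 ?(le_trans _ t1) //.
by rewrite ler_wpM2r // ler_weXn2l // size_bseq.
Qed.

Lemma tnorm_degree_part k g : tnorm (degree_part k g) <= tnorm g.
Proof.
by apply: ler_sum => w _; rewrite -!/(tcoef _ _) tcoef_degree_part; case: ifP; rewrite ?normr0.
Qed.

(** Modulo order k + 1 each factor is 1 + F j, and cross terms have order 2k, which is at least k +
    1. *)
Lemma order_ge_prod_texp J (r : seq J) (F : J -> T) k : (0 < k)%N ->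
    (forall j, order_ge k (F j)) ->
  order_ge k.+1 (\prod_(j <- r) texp (F j) - 1 - \sum_(j <- r) F j).
Proof.
move=> k0 Fk; elim: r => [|j r IHr].
  by rewrite !big_nil subrr subr0; exact: order_ge0.
rewrite !big_cons; set Q := \prod_(_ <- _) _; set S := \sum_(_ <- _) _.
rewrite -/Q -/S in IHr.
have Sk : order_ge k S by apply: order_ge_sum.
have Qk : order_ge k (Q - 1).
  by rewrite -[Q - 1](subrK S); apply: order_geD => //; exact: order_geW IHr.
have ek : order_ge k.+1 (texp (F j) - 1 - F j).
  have := texp_perturb k0 (@order_ge0 _ _ _ 1) (Fk j).
  by rewrite add0r texp0.
have ek' : order_ge k (texp (F j) - 1).
  by rewrite -[_ - 1](subrK (F j)); apply: order_geD => //; exact: order_geW ek.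
have -> : texp (F j) * Q - 1 - (F j + S) =
  (texp (F j) - 1 - F j) + (Q - 1 - S) + (texp (F j) - 1) * (Q - 1).
  by rewrite mulr_sub1 addrAC opprD (addrACA (texp _ - 1)).
apply: order_geD; first exact: order_geD.
by apply: order_geW (order_geM ek' Qk); rewrite -addn1 leq_add2l.
Qed.

End TensorNorm.

(** * Two-sided comparison of the homogeneous norm with the l1 norm *)

Section HomogeneousNorm.
Variables (R : realType) (V : vectType R) (m : nat).
Local Notation T := (ttensor V m).
Local Notation lie := (@free_lie R V m).
Local Notation G := (@free_nilpotent_group R V m).
Implicit Types (a b g h x y : T) (w : m.-bseq (letter V)) (t : R).
Variable nu : T -> R.
Hypothesis hnu : is_homogeneous_norm nu.

Let nu_ge0 g : G g -> 0 <= nu g. Proof. by case: hnu => + _ _ _ _; apply. Qed.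
Let nu_eq0 g : G g -> (nu g = 0 <-> g = 1).
Proof. by case: hnu => _ + _ _ _; apply. Qed.
Let nu_dil t g : G g -> nu (dilation t g) = `|t| * nu g.
Proof. by case: hnu => _ _ + _ _; apply. Qed.
Let nuM g h : G g -> G h -> nu (g * h) <= nu g + nu h.
Proof. by case: hnu => _ _ _ + _; apply. Qed.
Let nuV g : G g -> nu g^-1 = nu g.
Proof. by case: hnu => _ _ _ _; apply. Qed.

Let nu1 : nu 1 = 0.
Proof. by apply/nu_eq0 => //; exact: group1. Qed.

Lemma group_prod_texp J (r : seq J) (F : J -> T) : (forall j, lie (F j)) ->
  G (\prod_(j <- r) texp (F j)) /\
  nu (\prod_(j <- r) texp (F j)) <= \sum_(j <- r) nu (texp (F j)).
Proof.
move=> lF; elim: r => [|j r [Gr nr]].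
  by rewrite !big_nil nu1; split=> //; exact: group1.
rewrite !big_cons; split; first by apply: groupM => //; exact: group_texp.
apply: le_trans (nuM (group_texp (lF j)) Gr) _.
by rewrite lerD2l.
Qed.

(** The sign of c is removed by symmetry of [nu], since exp(-x) is the inverse of exp(x); its
    modulus is the effect of the dilation by s = |c|^(1/k). *)
Lemma nu_texp_homogeneous k b K (c : R) : (0 < k)%N -> 0 <= K -> lie b ->
  degree_part k b = b -> `|c| <= K -> nu (texp (c *: b)) <= (K + 1) * nu (texp b).
Proof.
move=> k0 K0 lb bk cK.
have -> : nu (texp (c *: b)) = nu (texp (`|c| *: b)).
  have [c0|c0] := leP 0 c; first by rewrite ger0_norm.
  rewrite ltr0_norm // scaleNr -texpV ?nuV //.
    exact/group_texp/free_lieZ.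
  exact/free_lie_order_ge1/free_lieZ.
pose s := `|c| `^ k%:R^-1; have s0 : 0 <= s by exact: powR_ge0.
have sk : s ^+ k = `|c|.
  by rewrite /s -powR_mulrn // -powRrM mulVf ?pnatr_eq0 -?lt0n // powRr1.
have -> : texp (`|c| *: b) = dilation s (texp b).
  by rewrite dilation_texp -bk dilation_degree_part sk.
rewrite nu_dil; last exact: group_texp.
rewrite ger0_norm // ler_wpM2r ?nu_ge0 //; first exact: group_texp.
rewrite -(@ler_pXn2r _ k) ?nnegrE ?addr_ge0 // sk.
(* Since K + 1 is at least 1, s^k <= K <= (K + 1)^k, whence s <= K + 1. *)
apply: le_trans cK _; apply: (@le_trans _ _ (K + 1)); first by rewrite lerDl.
by rewrite ler_eXnr // lerDr.
Qed.

(** Descending induction on the order k of g - 1. At k = m + 1 only g = 1 remains; otherwise g =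
    h^-1 (h g), where h cancels the degree k part of g and h g falls under the induction hypothesis
    with a larger radius. *)
Lemma nu_bounded_order n k : (0 < k)%N -> (k + n)%N = m.+1 -> forall M,
  exists C, forall g, G g -> order_ge k (g - 1) -> tnorm g <= M -> nu g <= C.
Proof.
elim: n k => [|n IHn] k k0 kn M.
  exists 0 => g Gg; rewrite addn0 in kn; rewrite kn.
  move=> /order_ge_eq0/eqP; rewrite subr_eq0 => /eqP -> _.
  by rewrite nu1.
pose P x := lie x /\ degree_part k x = x.
have [||c x [lx xk]|l [b [c [C [Pb C0 hb hc]]]]] :=
  @subspace_coordinates R (m.-bseq (letter V)) P.
- split; first exact: free_lie0.
  by apply/ttensorP => w; rewrite tcoef_degree_part tcoef0 if_same.
- move=> x y [lx xk] [ly yk]; split; first exact: free_lieD.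
  by rewrite degree_partD xk yk.
- split; first exact: free_lieZ.
  by rewrite degree_partZ xk.
(* [K] bounds the coordinates of the degree k part of g - 1, as |g - 1| <= M + 1. The maximum makes
   it nonnegative for every M. *)
pose K := C * (Num.max M 0 + 1).
have K0 : 0 <= K by rewrite mulr_ge0 // addr_ge0 // le_max lexx orbT.
(* [B] bounds each factor exp(-c_i b_i), hence B^l bounds their product h. *)
have [B B0 hB] := texp_bounded V m (\sum_i K * tnorm (b i)).
have [C' hC'] := IHn k.+1 isT (etrans (addSnnS _ _) kn) (B ^+ l * Num.max M 0).
exists (\sum_i (K + 1) * nu (texp (b i)) + C') => g Gg gk gM.
have [a la ga] := Gg; have a1 := free_lie_order_ge1 la.
pose x := degree_part k a.
(* The lowest degree part of g - 1 is that of log g, so it is a Lie element. *)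
have xg : x = degree_part k (g - 1).
  have ak : order_ge k a by apply: texp_sub1_order_ge => //; rewrite ga.
  have := texp_perturb k0 (@order_ge0 _ _ _ 1) ak.
  rewrite add0r texp0 ga => /degree_part_order_ge; rewrite degree_partB => /eqP.
  by rewrite subr_eq0 => /eqP ->.
have Px : P x by split; [exact: free_lie_degree_part | exact: degree_part_id].
have ck i : `|- c i x| <= K.
  rewrite normrN; apply: le_trans (hc _ _) _; rewrite /K ler_wpM2l //.
  rewrite -/(tnorm x) xg; apply: le_trans (tnorm_degree_part _ _) _.
  apply: le_trans (tnormD _ _) _; rewrite tnormN tnorm1 lerD2r.
  by rewrite le_max gM.
have lcb i : lie (- c i x *: b i) by apply: free_lieZ; case: (Pb i).
pose h := \prod_(i <- enum 'I_l) texp (- c i x *: b i).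
have [Gh nuh] := group_prod_texp (enum 'I_l) lcb.
have hk : order_ge k.+1 (h - 1 + x).
  have -> : x = - \sum_(i <- enum 'I_l) - c i x *: b i.
    rewrite -sumrN (hb _ Px) big_enum /=; apply: eq_bigr => i _.
    by rewrite scaleNr opprK -hb.
  apply: order_ge_prod_texp => // i; apply: order_geZ.
  by rewrite -(Pb i).2; exact: order_ge_degree_part.
have hk' : order_ge k (h - 1).
  rewrite -[h - 1](addrK x); apply: order_geB; first exact: order_geW hk.
  exact: order_ge_degree_part.
have nuh' : nu h <= \sum_i (K + 1) * nu (texp (b i)).
  apply: le_trans nuh _; rewrite big_enum /=; apply: ler_sum => i _.
  by have [lb bk] := Pb i; exact: (nu_texp_homogeneous k0).
have th : tnorm h <= B ^+ l.
  have : tnorm h <= B ^+ size (enum 'I_l).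
    rewrite /h; elim: (enum _) => [|i r IHr]; first by rewrite big_nil tnorm1.
    rewrite big_cons exprS; apply: le_trans (tnormM _ _) _.
    rewrite ler_pM ?tnorm_ge0 //; apply: hB.
    rewrite tnormZ (bigD1 i) //= -[leLHS]addr0 lerD //.
      by rewrite ler_wpM2r ?tnorm_ge0.
    by apply: sumr_ge0 => j _; rewrite mulr_ge0 ?tnorm_ge0.
  by rewrite size_enum_ord.
have -> : g = h^-1 * (h * g) by rewrite mulKr // (group_unit Gh).
have Ghg := groupM Gh Gg.
apply: le_trans (nuM (groupV Gh) Ghg) _; rewrite nuV // lerD //.
apply: hC' => //.
  have -> : h * g - 1 = (h - 1 + x) + (g - 1 - x) + (h - 1) * (g - 1).
    by rewrite mulr_sub1 (addrACA (h - 1)) subrr addr0.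
  apply: order_geD; first apply: order_geD => //.
    by rewrite xg; exact: order_geS.
  by apply: order_geW (order_geM hk' gk); rewrite -addn1 leq_add2l.
apply: le_trans (tnormM _ _) _; rewrite ler_pM ?tnorm_ge0 //.
by rewrite le_max gM.
Qed.

Lemma nu_bounded M :
  exists2 C, 0 <= C & forall g, G g -> tnorm g <= M -> nu g <= C.
Proof.
have [C hC] := @nu_bounded_order m 1 isT (add1n m) M.
exists (Num.max C 0) => [|g Gg gM]; first by rewrite le_max lexx orbT.
by rewrite le_max hC //; exact: group_sub1.
Qed.

Hypothesis hm : (0 < m)%N.

Lemma root_powR (e : R) : 0 <= e -> (e `^ (1 / m%:R)) ^+ m = e.
Proof.
move=> e0; rewrite -powR_mulrn ?powR_ge0 // -powRrM mul1r mulVf ?powRr1 //.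
by rewrite pnatr_eq0 -lt0n.
Qed.

(** The dilation by 1/s, with s = e^(1/m) <= 1, multiplies |g - 1| by at most s^-m = 1/e, which
    brings g into the ball of radius K + 1, where [nu] is bounded. *)
Lemma nu_le_root K : 0 <= K -> exists2 C, 0 <= C & forall g e, G g ->
  0 < e -> e <= 1 -> tnorm (g - 1) <= K * e -> nu g <= C * e `^ (1 / m%:R).
Proof.
move=> K0; have [C C0 hC] := nu_bounded (K + 1); exists C => // g e Gg e0 e1 ge.
pose s := e `^ (1 / m%:R); have s0 : 0 < s by exact: powR_gt0.
have sm : s ^+ m = e by rewrite root_powR // ltW.
have s1 : 1 <= s^-1.
  by rewrite invf_ge1 // -(@expr_le1 _ m) ?sm // ltW.
have := hC _ (group_dilation s^-1 Gg) _.
rewrite nu_dil // ger0_norm ?invr_ge0 ?(ltW s0) // ler_pdivrMl // mulrC; apply.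
rewrite -[dilation _ _](subrK 1); apply: le_trans (tnormD _ _) _.
rewrite tnorm1 lerD2r -{1}(dilation1 _ _ s^-1) -dilationB.
apply: le_trans (tnorm_dilation _ s1) _.
by rewrite exprVn sm ler_pdivrMl // mulrC.
Qed.

(** Compactness, with semicontinuity from subadditivity: nu(exp z) <= nu(exp x) + nu(exp(-x) exp z),
    and the last term is small by [nu_le_root]. *)
Lemma nu_texp_lower_bound M : exists2 c, 0 < c &
  forall a, lie a -> 1 <= tnorm a -> tnorm a <= M -> c <= nu (texp a).
Proof.
have [L L0 hL] := texp_lipschitz V m M.
have [B B0 hB] := texp_bounded V m M.
have [C C0 hC] := nu_le_root (mulr_ge0 B0 L0).
pose P a := [/\ lie a, 1 <= tnorm a & tnorm a <= M].
have Pnear z x e : l1norm (x - z) < e ->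
    tnorm x <= tnorm z + e /\ tnorm z <= tnorm x + e.
  move=> /ltW xz; split.
    rewrite -[x in leLHS](subrK z) addrC; apply: le_trans (tnormD _ _) _.
    by rewrite lerD2l.
  rewrite -[z in leLHS](subrK x) addrC; apply: le_trans (tnormD _ _) _.
  by rewrite lerD2l tnorm_distC.
have [||||c c0 hc] := @compact_lower_bound R (m.-bseq (letter V)) P (nu \o @texp R V m) M.
- by move=> x [].
- move=> z hz; split.
  + apply: (@subspace_closed R (m.-bseq (letter V)) lie (free_lie0 V m)).
    * by move=> x y; exact: free_lieD.
    * by move=> c x; exact: free_lieZ.
    * by move=> e /hz[x [lx _ _] xz]; exists x.
  + apply/ler_addgt0Pr => e /hz[x [_ x1 _]] /Pnear[xz _].
    exact: le_trans xz.
  + apply/ler_addgt0Pr => e /hz[x [_ _ xM]] /Pnear[_ zx].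
    by apply: le_trans zx _; rewrite lerD2r.
- move=> a [la a1 _] /=; have Ga := group_texp la.
  rewrite lt_neqAle nu_ge0 // andbT eq_sym; apply/eqP => /(nu_eq0 Ga) ea.
  have : order_ge m.+1 a.
    apply: texp_sub1_order_ge; first exact: free_lie_order_ge1.
    by rewrite ea subrr; exact: order_ge0.
  by move=> /order_ge_eq0 a0; move: a1; rewrite a0 tnorm0 ler10.
- move=> z [lz z1 zM] e e0 /=.
  (* Chosen so that C s^(1/m) <= e, while s <= 1 as [nu_le_root] demands. *)
  pose s := Num.min 1 ((e / (C + 1)) ^+ m).
  have C1 : 0 < C + 1 by rewrite ltr_wpDl.
  have eC : 0 < e / (C + 1) by rewrite divr_gt0.
  have s0 : 0 < s by rewrite lt_min ltr01 exprn_gt0.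
  exists s => // x [lx x1 xM] /ltW xz.
  have Gx := group_texp lx; have Gz := group_texp lz.
  have Gxz := groupM (groupV Gx) Gz.
  rewrite -[texp z](mulVKr (group_unit Gx)); apply: le_trans (nuM Gx Gxz) _.
  rewrite lerD2l; apply: le_trans (hC _ s Gxz s0 _ _) _.
  + by rewrite ge_min lexx.
  + rewrite -[X in _ - X](mulVr (group_unit Gx)) -mulrBr.
    apply: le_trans (tnormM _ _) _; rewrite -mulrA ler_pM ?tnorm_ge0 //.
      rewrite texpV; last exact: free_lie_order_ge1.
      by apply: hB; rewrite tnormN.
    apply: le_trans (hL _ _ zM xM) _; rewrite ler_wpM2l // tnorm_distC.
    exact: xz.
  + apply: (@le_trans _ _ (C * (e / (C + 1)))).
      rewrite ler_wpM2l // -(@ler_pXn2r _ m) ?nnegrE ?powR_ge0 ?(ltW eC) //.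
      by rewrite root_powR ?(ltW s0) // ge_min lexx orbT.
    by rewrite mulrCA ger_pMr // ler_pdivrMr // mul1r lerDl.
by exists c => // a la a1 aM; exact: hc.
Qed.

(** Let v maximize |a_u|^(1/|u|). Dilating a by the inverse of this maximum makes the coefficient of
    v of modulus 1 and all others at most 1, so the norm lies between 1 and the number of words,
    where [nu_texp_lower_bound] applies. *)
Lemma tcoef_le_nu : exists2 C, 1 <= C & forall a w, lie a ->
  `|tcoef a w| <= (C * nu (texp a)) ^+ size w.
Proof.
have [c c0 hc] := nu_texp_lower_bound #|{: m.-bseq (letter V)}|%:R.
exists (Num.max c^-1 1) => [|a w la]; first by rewrite le_max lexx orbT.
have Ga := group_texp la.
have C0 : 0 <= Num.max c^-1 1 :> R by rewrite le_max ler01 orbT.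
have [w0|w0] := eqVneq (tcoef a w) 0.
  by rewrite w0 normr0 exprn_ge0 // mulr_ge0 // nu_ge0.
have w_gt0 u : tcoef a u != 0 -> (0 < size u)%N.
  by apply: contraNT; rewrite -leqNgt => u0; rewrite (free_lie_order_ge1 la).
pose r u := `|tcoef a u| `^ (size u)%:R^-1.
have rX u : tcoef a u != 0 -> r u ^+ size u = `|tcoef a u|.
  move=> u0; rewrite -powR_mulrn ?powR_ge0 // -powRrM mulVf ?powRr1 //.
  by rewrite pnatr_eq0 -lt0n w_gt0.
case: (@arg_maxP _ R _ w (fun u => tcoef a u != 0) r w0) => v v0 maxv.
have rv0 : 0 < r v by rewrite powR_gt0 ?normr_gt0.
have dle u : `|tcoef (dilation (r v)^-1 a) u| <= 1.
  rewrite tcoef_dilation normrM; have [->|u0] := eqVneq (tcoef a u) 0.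
    by rewrite normr0 mulr0.
  rewrite exprVn ger0_norm ?invr_ge0 ?exprn_ge0 ?(ltW rv0) //.
  rewrite ler_pdivrMl ?exprn_gt0 // mulr1 -rX //.
  by rewrite lerXn2r ?nnegrE ?powR_ge0 //; exact: maxv.
have : c <= nu (texp (dilation (r v)^-1 a)).
  apply: hc; first exact: free_lie_dilation.
    apply: le_trans (ler_tcoef_tnorm _ v).
    rewrite tcoef_dilation normrM exprVn ger0_norm ?invr_ge0 ?exprn_ge0 ?(ltW rv0) //.
    by rewrite rX // mulVf // normr_eq0.
  rewrite tnormE; apply: (@le_trans _ _ (\sum_(u : m.-bseq (letter V)) 1)).
    by apply: ler_sum => u _; exact: dle.
  by rewrite sumr_const.
rewrite -dilation_texp nu_dil // ger0_norm ?invr_ge0 ?(ltW rv0) //.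
rewrite ler_pdivlMl // mulrC -ler_pdivlMl // => rc.
rewrite -rX // lerXn2r ?nnegrE ?powR_ge0 ?mulr_ge0 ?nu_ge0 //.
apply: le_trans (maxv _ w0) _; apply: le_trans rc _.
by rewrite ler_wpM2r ?nu_ge0 // le_max lexx.
Qed.

(** For nonempty words, nu^|w| <= nu <= e because e <= 1, and C^|w| <= C^m because C >= 1. The
    Lipschitz bound for exp carries the estimate from log g to g - 1. *)
Lemma tnorm_le_nu : exists2 C, 0 <= C & forall g e, G g ->
  e <= 1 -> nu g <= e -> tnorm (g - 1) <= C * e.
Proof.
have [C C1 hC] := tcoef_le_nu.
have C0 : 0 <= C by exact: le_trans C1.
pose M := #|{: m.-bseq (letter V)}|%:R * C ^+ m.
have M0 : 0 <= M by rewrite mulr_ge0 // exprn_ge0.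
have [L L0 hL] := texp_lipschitz V m M.
exists (L * M) => [|_ e [a la <-] e1 ne]; first exact: mulr_ge0.
have nu0 := nu_ge0 (group_texp la).
have e0 : 0 <= e by exact: le_trans ne.
have aM : tnorm a <= M * e.
  rewrite tnormE; apply: (@le_trans _ _ (\sum_(u : m.-bseq (letter V)) C ^+ m * e)).
    apply: ler_sum => w _; have [w0|w0] := posnP (size w).
      by rewrite (free_lie_order_ge1 la) ?w0 // normr0 mulr_ge0 // exprn_ge0.
    apply: le_trans (hC _ _ la) _; rewrite exprMn ler_pM ?exprn_ge0 //.
      by rewrite ler_weXn2l // size_bseq.
    apply: (le_trans _ ne); rewrite -[leRHS]expr1 ler_wiXn2l //.
    exact: (le_trans ne).
  by rewrite sumr_const -mulr_natl mulrA.
have aM' : tnorm a <= M by apply: le_trans aM _; rewrite ler_piMr.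
rewrite -(@texp0 R V m); apply: le_trans (hL _ _ aM' _) _.
  by rewrite tnorm0.
by rewrite subr0 -mulrA ler_wpM2l.
Qed.

End HomogeneousNorm.

(** * Comparison of the l1 norm with the given norms on each degree *)

Section Components.
Variables (R : realType) (V : vectType R) (m : nat).
Local Notation T := (ttensor V m).
Implicit Types (g h x : T) (w : m.-bseq (letter V)).

Lemma componentB g h k : component (g - h) k = component g k - component h k.
Proof.
apply/ffunP => w; rewrite !ffunE; case: insubP => [u _ _|_] /=; last by rewrite subrr.
exact: tcoefB.
Qed.

Lemma component_dilation (t : R) g k :
  component (dilation t g) k = t ^+ k *: component g k.
Proof.
apply/ffunP => w; rewrite !ffunE; case: insubP => [u _ e|_] /=; last by rewrite [RHS]mulr0.
by rewrite tcoef_dilation e size_tuple.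
Qed.

Lemma component_tcoef g w : component g (size w) (in_tuple w) = tcoef g w.
Proof. by rewrite ffunE /= valK. Qed.

Lemma component_le_tnorm_coord g k u : `|component g k u| <= tnorm g.
Proof.
rewrite ffunE; case: insubP => [w _ _|_] /=; first exact: ler_tcoef_tnorm.
by rewrite normr0 tnorm_ge0.
Qed.

Variables (N : forall k, tensor V k -> R).
Hypothesis hN : forall k, is_norm (@N k).

(** Norm equivalence degree by degree; [order_ge 1] takes care of degree 0, on which the bound by e
    says nothing. *)
Lemma tnorm_le_component : exists2 C, 0 <= C & forall x e, 0 <= e ->
  order_ge 1 x -> (forall k, (1 <= k <= m)%N -> N (component x k) <= e) ->
  tnorm x <= C * e.
Proof.
have hC k : exists C : R, 0 <= C /\ forall y, l1norm y <= C * N (y : tensor V k).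
  by have [C C0 hC] := l1norm_le_norm (hN k); exists C.
have {hC}[C hC] := choice hC.
exists (\sum_(w : m.-bseq (letter V)) C (size w)).
  by apply: sumr_ge0 => w _; case: (hC (size w)).
move=> x e e0 x1 xe; rewrite tnormE mulr_suml; apply: ler_sum => w _.
have [C0 {}hC] := hC (size w).
have [w0|w0] := posnP (size w); first by rewrite x1 ?w0 // normr0 mulr_ge0 // -w0.
rewrite -component_tcoef; apply: le_trans (ler_coord_l1norm _ _) _.
apply: le_trans (hC _) _; rewrite ler_wpM2l // xe // w0.
exact: size_bseq.
Qed.

Lemma component_le_tnorm : exists2 C, 0 <= C & forall x k, (k <= m)%N ->
  N (component x k) <= C * tnorm x.
Proof.
have hC k : exists C : R, 0 <= C /\ forall y, N (y : tensor V k) <= C * l1norm y.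
  have [ND NZ _] := hN k.
  by have [C C0 hC] := seminorm_le_l1norm ND NZ; exists C.
have {hC}[C hC] := choice hC.
pose D k := C k * #|{: k.-tuple (letter V)}|%:R.
have D0 k : 0 <= D k by rewrite mulr_ge0 //; case: (hC k).
exists (\sum_(k < m.+1) D k) => [|x k km]; first exact: sumr_ge0.
apply: (@le_trans _ _ (D k * tnorm x)).
  apply: le_trans ((hC k).2 _) _; rewrite -mulrA ler_wpM2l //; first by case: (hC k).
  apply: (@le_trans _ _ (\sum_(u : k.-tuple (letter V)) tnorm x)).
    by apply: ler_sum => u _; exact: component_le_tnorm_coord.
  by rewrite sumr_const mulr_natl.
rewrite ler_wpM2r ?tnorm_ge0 // (bigD1 (Ordinal (km : (k < m.+1)%N))) //=.
by rewrite lerDl sumr_ge0.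
Qed.

(** Dilating by om^(-1/p) divides degree k by om^(k/p), which is exactly the weight in
    [scaled_diff]. The sign of e accounts for the initial value 0 of the maximum. *)
Lemma scaled_diff_leP (p om e : R) g h : 0 < p -> 0 < om -> 0 <= e ->
  scaled_diff (@N) p om g h <= e <->
  forall k, (1 <= k <= m)%N ->
    N (component (dilation (om `^ (1 / p))^-1 g - dilation (om `^ (1 / p))^-1 h) k) <= e.
Proof.
move=> p0 om0 e0; set s := om `^ (1 / p); have s0 : 0 < s by exact: powR_gt0.
have eqN k : N (component (dilation s^-1 g - dilation s^-1 h) k) =
    N (component g k - component h k) / om `^ (k%:R / p).
  have [_ NZ _] := hN k; rewrite -dilationB component_dilation NZ componentB.
  rewrite exprVn ger0_norm ?invr_ge0 ?exprn_ge0 ?(ltW s0) // mulrC.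
  by rewrite -powR_mulrn ?(ltW s0) // -powRrM mul1r [p^-1 * _]mulrC.
split=> [le_e k km|le_e].
  rewrite eqN; apply: le_trans le_e; rewrite /scaled_diff.
  apply: (@unstable.le_bigmax_seq _ R 0 nat (index_iota 1 m.+1) k xpredT
    (fun k => N (component g k - component h k) / om `^ (k%:R / p))) => //.
  by rewrite mem_index_iota.
rewrite /scaled_diff big_nat; apply: bigmax_le => // k km.
by rewrite -eqN; exact: le_e.
Qed.

End Components.

(** * The left and right distances on the unit ball *)

Section Distances.
Variables (R : realType) (V : vectType R) (m : nat).
Local Notation T := (ttensor V m).
Local Notation G := (@free_nilpotent_group R V m).
Implicit Types (g h : T).
Variables (nu : T -> R) (d : T -> T -> R).
Hypotheses (hnu : is_homogeneous_norm nu)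
  (hd : d = dist_left nu \/ d = dist_right nu).

Lemma dist_dilation (t : R) g h : 0 <= t -> G g -> G h ->
  d (dilation t g) (dilation t h) = t * d g h.
Proof.
move=> t0 Gg Gh; have [_ _ nu_dil _ _] := hnu.
have [-> | ->] := hd; rewrite /dist_left /dist_right -dilationV // -dilationM.
  by rewrite nu_dil ?ger0_norm //; apply: groupM => //; exact: groupV.
by rewrite nu_dil ?ger0_norm //; apply: groupM => //; exact: groupV.
Qed.

(** Here u - 1 is g^-1 (h - g) on the left and (g - h) h^-1 on the right. The sums of norms let one
    statement cover both cases. *)
Lemma dist_tnorm g h : G g -> G h -> exists u, [/\ G u, d g h = nu u,
    tnorm (u - 1) <= (tnorm g^-1 + tnorm h^-1) * tnorm (g - h)
  & tnorm (g - h) <= (tnorm g + tnorm h) * tnorm (u - 1)].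
Proof.
move=> Gg Gh; have ug := group_unit Gg; have uh := group_unit Gh.
have [-> | ->] := hd.
- exists (g^-1 * h); split=> //; first by apply: groupM => //; exact: groupV.
    rewrite -[X in _ - X](mulVr ug) -mulrBr; apply: le_trans (tnormM _ _) _.
    by rewrite tnorm_distC ler_wpM2r ?tnorm_ge0 // lerDl tnorm_ge0.
  rewrite tnorm_distC -[h in leLHS](mulVKr ug) -[X in _ - X]mulr1 -mulrBr.
  apply: le_trans (tnormM _ _) _.
  by rewrite ler_wpM2r ?tnorm_ge0 // lerDl tnorm_ge0.
- exists (g * h^-1); split=> //; first by apply: groupM => //; exact: groupV.
    rewrite -[X in _ - X](mulrV uh) -mulrBl; apply: le_trans (tnormM _ _) _.
    by rewrite mulrC ler_wpM2r ?tnorm_ge0 // lerDr tnorm_ge0.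
  rewrite -[g in leLHS](mulrVK uh) -[X in _ - X]mul1r -mulrBl.
  apply: le_trans (tnormM _ _) _.
  by rewrite mulrC ler_wpM2r ?tnorm_ge0 // lerDr tnorm_ge0.
Qed.

Lemma dist_comparison (hm : (0 < m)%N) K : 0 <= K -> exists2 C, 0 <= C &
  forall g h e, G g -> G h -> nu g <= 1 -> nu h <= 1 -> 0 < e -> e <= 1 ->
    (tnorm (g - h) <= K * e -> d g h <= C * e `^ (1 / m%:R)) /\
    (d g h <= e -> tnorm (g - h) <= C * e).
Proof.
move=> K0; have [C1 C10 hC1] := tnorm_le_nu hnu hm.
have nuV : forall g, G g -> nu g^-1 = nu g by case: hnu.
have tB g : G g -> nu g <= 1 -> tnorm g <= C1 + 1.
  move=> Gg g1; rewrite -[g](subrK 1); apply: le_trans (tnormD _ _) _.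
  by rewrite tnorm1 lerD2r -[C1]mulr1; exact: hC1.
have tVB g : G g -> nu g <= 1 -> tnorm g^-1 <= C1 + 1.
  by move=> Gg g1; apply: tB; [exact: groupV | rewrite nuV].
(* Elements of the unit ball and their inverses have l1 norm at most C1 + 1, so [B] bounds both sums
   in [dist_tnorm]. *)
pose B := (C1 + 1) + (C1 + 1); have B0 : 0 <= B by rewrite !addr_ge0.
have [C2 C20 hC2] := nu_le_root hnu hm (mulr_ge0 B0 K0).
exists (C2 + B * C1) => [|g h e Gg Gh g1 h1 e0 e1].
  by rewrite addr_ge0 // mulr_ge0.
have [u [Gu -> le_u le_gh]] := dist_tnorm Gg Gh; split=> [ghe|ue].
  apply: (@le_trans _ _ (C2 * e `^ (1 / m%:R))).
    apply: hC2 => //; apply: le_trans le_u _; rewrite -mulrA.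
    by rewrite ler_pM ?addr_ge0 ?tnorm_ge0 // lerD // tVB.
  by rewrite ler_wpM2r ?powR_ge0 // lerDl mulr_ge0.
apply: (@le_trans _ _ (B * C1 * e)); last by rewrite ler_wpM2r ?(ltW e0) // lerDr.
apply: le_trans le_gh _; rewrite -mulrA ler_pM ?addr_ge0 ?tnorm_ge0 //.
  by rewrite lerD // tB.
exact: hC1.
Qed.

End Distances.

(** * Rescaling of the increments and conclusion *)

Theorem corollary5 (R : realType) (V : vectType R) (m : nat) (hm : (1 <= m)%N)
    (N : forall k : nat, tensor V k -> R)
    (hN : forall k : nat, is_norm (N k))
    (hNM : forall (i j : nat) (a : tensor V i) (b : tensor V j),
        N (i + j)%N (tensor_mul a b) <= N i a * N j b)
    (nu : ttensor V m -> R) (hnu : is_homogeneous_norm nu)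
    (d : ttensor V m -> ttensor V m -> R)
    (hd : d = dist_left nu \/ d = dist_right nu) :
  exists c : R -> R,
    forall (p : R) (om : R -> R -> R) (X Y : R -> ttensor V m),
      1 <= p ->
      is_control om -> zero_only_on_diagonal om ->
      is_group_path X -> is_group_path Y ->
      pvar_controlled nu p om X -> pvar_controlled nu p om Y ->
      forall eps : R, 0 < eps -> eps < 1 / Num.max (om 0 1) 1 ->
      forall s t : R, 0 <= s -> s < t -> t <= 1 ->
        (scaled_diff N p (om s t) (increment X s t) (increment Y s t) <= eps ->
         d (increment X s t) (increment Y s t)
           <= c (path_sup_norm nu X) * eps `^ (1 / m%:R) * om s t `^ (1 / p))
        /\
        (d (increment X s t) (increment Y s t) <= eps * om s t `^ (1 / p) ->
         scaled_diff N p (om s t) (increment X s t) (increment Y s t)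
           <= c (path_sup_norm nu X) * eps).
Proof.
have [K K0 hK] := tnorm_le_component m hN.
have [K' K'0 hK'] := component_le_tnorm m hN.
have [C C0 hC] := dist_comparison hnu hd hm K0.
(* [C] serves the first implication; in the second, [K'] is the cost of returning from the l1 norm
   to the norms [N]. *)
exists (fun=> C + K' * C) => p om X Y p1 [_ om_ge0 _ _] om_diag [GX _ _] [GY _ _].
move=> nuX nuY e e0 e_lt s t s0 st t1.
have p0 : 0 < p by exact: lt_le_trans p1.
have sst : simplex (s, t) by split=> //; exact: ltW.
have e1 : e <= 1.
  apply/ltW/(lt_le_trans e_lt); rewrite mul1r invf_le1 ?le_max ?lexx ?orbT //.
  by rewrite lt_max ltr01 orbT.
have omst : 0 < om s t.
  rewrite lt_neqAle om_ge0 // andbT eq_sym; apply/eqP => /(om_diag _ _ sst) st_eq.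
  by rewrite st_eq ltxx in st.
have Gincr (Z : R -> ttensor V m) :
    (forall r, 0 <= r <= 1 -> free_nilpotent_group (Z r)) ->
    free_nilpotent_group (increment Z s t).
  move=> GZ; apply: groupM; first apply: groupV; apply: GZ.
    by rewrite s0 (le_trans (ltW st)).
  by rewrite t1 (le_trans s0 (ltW st)).
have {GX}Gx := Gincr X GX; have {GY}Gy := Gincr Y GY.
move: (increment X s t) (increment Y s t) Gx Gy (nuX s t sst) (nuY s t sst).
move=> x y Gx Gy nux nuy.
set a := om s t `^ (1 / p); have a0 : 0 < a by exact: powR_gt0.
have [nu_ge0 _ nu_dil _ _] := hnu.
(* The control gives nu(g) <= om^(1/p) = a, so the dilation by 1/a maps g into the unit ball. *)
have nu_le1 g : free_nilpotent_group g -> nu g `^ p <= om s t ->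
    nu (dilation a^-1 g) <= 1.
  move=> Gg gp; rewrite nu_dil // ger0_norm ?invr_ge0 ?(ltW a0) //.
  have -> : nu g = (nu g `^ p) `^ (1 / p).
    by rewrite -powRrM mul1r mulfV ?lt0r_neq0 // powRr1 // nu_ge0.
  rewrite ler_pdivrMl // mulr1 ge0_ler_powR ?nnegrE ?powR_ge0 ?(ltW omst) //.
  by rewrite mul1r invr_ge0 ltW.
have [toD toN] := hC _ _ e (group_dilation a^-1 Gx) (group_dilation a^-1 Gy)
  (nu_le1 _ Gx nux) (nu_le1 _ Gy nuy) e0 e1.
rewrite (dist_dilation hnu hd) ?invr_ge0 ?(ltW a0) // in toD toN.
have CC : C <= C + K' * C by rewrite lerDl mulr_ge0.
split=> [/(scaled_diff_leP hN x y p0 omst (ltW e0)) le_e|le_e].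
  rewrite mulrC -ler_pdivrMl //; apply: (@le_trans _ _ (C * e `^ (1 / m%:R))).
    apply: toD; apply: hK => //; first exact: ltW.
    (* Both dilated increments have scalar part 1, so their difference has order 1. *)
    by rewrite -(subrKA 1) -[1 - _]opprB; apply: order_geB;
      exact/group_sub1/group_dilation.
  by rewrite ler_wpM2r ?powR_ge0.
apply/(scaled_diff_leP hN) => //.
  by rewrite mulr_ge0 ?(ltW e0) // addr_ge0 // mulr_ge0.
move=> k /andP[_ km]; apply: le_trans (hK' _ _ km) _.
apply: (@le_trans _ _ (K' * (C * e))).
  by rewrite ler_wpM2l //; apply: toN; rewrite ler_pdivrMl // mulrC.
by rewrite mulrA ler_wpM2r ?(ltW e0) // lerDr.
Qed.
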